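(* Let $Z\sim N_d(\theta,\sigma^2 I_d)$ and, independently, $S\sim\sigma^2\chi^2_n$, with $\theta\in\mathbb{R}^d$ and $\sigma^2>0$ both unknown, and let $\hat\sigma^2=s/(n+2)$ and $p>0$. Assume $d\ge 3$ and $0\le\alpha<(d-2)/(d-1)$, and put $$\gamma(d,p,\alpha)=\min\bigl(1,d^{(2-p-\alpha)/p}\bigr)\left\{1-\alpha\frac{d-1}{d-2}\right\}.$$ Assume $\phi(u)$ is absolutely continuous and $0\le\phi(u)\le 2(d-2)\gamma(d,p,\alpha)$. Assume further that, over all $u$ with $\phi(u)<2(d-2)\gamma(d,p,\alpha)$, $$g_\phi(u)=\frac{u^{d-2-\alpha(d-1)}\phi(u)}{\{2(d-2)\gamma(d,p,\alpha)-\phi(u)\}^{1+2\{d-2-\alpha(d-1)\}/(n+2)}}$$ is non-decreasing, and that if there exists $u_*>0$ such that $\phi(u_* )=2(d-2)\gamma(d,p,\alpha)$, then $\phi(u)=2(d-2)\gamma(d,p,\alpha)$ for all $u\ge u_*$. Then the estimator $\hat\theta_\phi$ with $i$-th component ($i=1,\dots,d$) $$\hat\theta_{i\phi}=\left(1-\frac{\hat\sigma^2\,\phi\bigl(\|z\|_p/\sqrt{\hat\sigma^2}\bigr)}{\|z\|_p^{2-\alpha}|z_i|^{\alpha}}\right)z_i$$ is minimax.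
   Context: For $p>0$, $\|z\|_p=\{\sum_{i=1}^d|z_i|^p\}^{1/p}$; $n\ge 1$ is the degrees of freedom. The lower-case $z,s$ denote the observed values of $Z,S$. The function $\phi$ is a real-valued function of $u\ge 0$. The loss of an estimator $\delta$ is $L(\delta,\theta)=\sum_{i=1}^d(\delta_i-\theta_i)^2/\sigma^2$ and its risk is $E[L(\delta(Z,S),\theta)]$. An estimator is minimax if it minimizes the supremum of the risk over the unknown parameters among all estimators. The estimator $z$ is minimax with constant risk $d$, so $\delta$ is minimax if and only if its risk is at most $d$ for every $\theta$ and $\sigma^2$. The estimator is defined for $z$ with all coordinates nonzero, which holds almost surely. *)

(* Defs.v *)
From HB Require Import structures.
From mathcomp Require Import all_boot all_order all_algebra.
From mathcomp Require Import all_classical all_reals all_analysis.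
From mathcomp Require Import measurable_realfun.

Set Implicit Arguments.
Unset Strict Implicit.
Unset Printing Implicit Defensive.

Import Order.TTheory GRing.Theory Num.Theory.
Import numFieldNormedType.Exports.

Local Open Scope classical_set_scope.
Local Open Scope ring_scope.

Section product_law.
Context {R : realType}.

Definition cons_tuple n (xw : R * n.-tuple R) : n.+1.-tuple R :=
  [tuple of xw.1 :: xw.2].

Lemma measurable_cons_tuple n :
  measurable_fun [set: R * n.-tuple R] (@cons_tuple n).
Proof. exact: measurable_cons measurable_fst measurable_snd. Qed.

HB.instance Definition _ n :=
  isMeasurableFun.Build _ _ (R * n.-tuple R)%type (n.+1.-tuple R)
    (@cons_tuple n) (@measurable_cons_tuple n).

(* The product measure mu_0 \x ... \x mu_(n-1); see product_law_rect. *)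
Fixpoint product_law n :
    ('I_n -> probability R R) -> probability (n.-tuple R) R :=
  match n with
  | 0 => fun _ => dirac [tuple]
  | m.+1 => fun mu =>
      distribution (mu ord0 \x product_law (fun i => mu (lift ord0 i)))%E
                   (@cons_tuple m)
  end.

Lemma measurable_tuple_rect n (A : 'I_n -> set R) :
  (forall i, measurable (A i)) ->
  measurable [set z : n.-tuple R | forall i, A i (tnth z i)].
Proof.
move=> mA.
rewrite (_ : [set z | _] =
    \big[setI/setT]_(i < n) (@tnth n R ^~ i @^-1` A i)).
  apply: bigsetI_measurable => i _.
  by rewrite -[X in measurable X]setTI; exact: measurable_tnth.
apply/seteqP; split=> z /=; first by move=> zA; rewrite -bigcap_seq => i _ /=.
by rewrite -bigcap_seq => zA i; apply: zA; rewrite /= mem_index_enum.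
Qed.

Lemma product_law_rect n (mu : 'I_n -> probability R R) (A : 'I_n -> set R) :
  (forall i, measurable (A i)) ->
  product_law mu [set z | forall i, A i (tnth z i)] =
  (\prod_(i < n) mu i (A i))%E.
Proof.
elim: n mu A => [|n IH] mu A mA.
  by rewrite big_ord0 /= diracE mem_set //= => -[].
rewrite big_ord_recl /= /distribution /pushforward /=.
rewrite -(IH (fun i => mu (lift ord0 i)) (fun i => A (lift ord0 i)))//.
rewrite -product_measure1E//; last first.
  by apply: (@measurable_tuple_rect n (fun i => A (lift ord0 i))).
congr (product_measure1 _ _ _); apply/seteqP; split=> -[x w] /=.
- move=> H; split; first exact: (H ord0).
  by move=> i; have := H (lift ord0 i); rewrite tnthS.
- move=> [Ax Aw] i; have [j ->|->] := unliftP ord0 i; last exact: Ax.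
  by rewrite tnthS; exact: Aw.
Qed.

(* The library's normal_prob, with standard deviation sqrt v, lives on
   measurableTypeR R, which has the same sigma-algebra as R but another
   display; idTR carries it over to R. *)
Definition idTR : measurableTypeR R -> R := idfun.

HB.instance Definition _ :=
  @isMeasurableFun.Build _ _ _ _ idTR (@measurable_id _ _ setT).

Definition normal1 (m v : R) : probability R R :=
  distribution (normal_prob m (Num.sqrt v)) idTR.

(* N_n(theta, v I_n) *)
Definition normal_vec n (theta : n.-tuple R) (v : R) :
    probability (n.-tuple R) R :=
  product_law (fun i => normal1 (tnth theta i) v).

Definition sum_sqr n (w : n.-tuple R) : R := \sum_(i < n) tnth w i ^+ 2.

Lemma measurable_sum_sqr n : measurable_fun [set: n.-tuple R] (@sum_sqr n).
Proof.
apply: measurable_sum => i; apply: measurable_funX; exact: measurable_tnth.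
Qed.

HB.instance Definition _ n :=
  isMeasurableFun.Build _ _ (n.-tuple R) R (@sum_sqr n) (@measurable_sum_sqr n).

(* Chi-square with n degrees of freedom: the law of N_1^2 + ... + N_n^2 for
   independent standard normal N_i. *)
Definition chi2 n : probability R R :=
  distribution (normal_vec [tuple of nseq n 0] 1) (@sum_sqr n).

End product_law.

Section decision.
Context {R : realType} {d : nat} {disp : measure_display}.
Context {Omega : measurableType disp}.

(* Under P theta v: Z ~ N_d(theta, v I_d) and, independently, S ~ v chi^2_n. *)
Definition normal_chi2_model (n : nat)
    (P : d.-tuple R -> R -> probability Omega R)
    (Z : {mfun Omega >-> d.-tuple R}) (S : {mfun Omega >-> R}) : Prop :=
  forall (theta : d.-tuple R) (v : R), 0 < v ->
  [/\ forall A, measurable A ->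
        distribution (P theta v) Z A = normal_vec theta v A,
      forall B, measurable B ->
        distribution (P theta v) S B = chi2 n ((fun x => v * x) @^-1` B)
    & forall A B, measurable A -> measurable B ->
        P theta v (Z @^-1` A `&` S @^-1` B) =
        (P theta v (Z @^-1` A) * P theta v (S @^-1` B))%E].

Definition estimator (delta : d.-tuple R -> R -> d.-tuple R) : Prop :=
  measurable_fun [set: d.-tuple R * R] (fun zs => delta zs.1 zs.2).

Definition loss (a theta : d.-tuple R) (v : R) : R :=
  \sum_(i < d) (tnth a i - tnth theta i) ^+ 2 / v.

Definition risk (P : d.-tuple R -> R -> probability Omega R)
    (Z : Omega -> d.-tuple R) (S : Omega -> R)
    (delta : d.-tuple R -> R -> d.-tuple R) (theta : d.-tuple R) (v : R) :
    \bar R :=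
  ('E_(P theta v)[fun w => loss (delta (Z w) (S w)) theta v])%E.

Definition max_risk P Z S delta : \bar R :=
  ereal_sup [set r | exists theta v, 0 < v /\ r = risk P Z S delta theta v].

Definition minimax P Z S delta : Prop :=
  estimator delta /\
  forall delta', estimator delta' ->
    (max_risk P Z S delta <= max_risk P Z S delta')%E.

End decision.

Section shrinkage.
Context {R : realType}.
Implicit Types (phi : R -> R).

Definition abs_cont_on phi (a b : R) : Prop :=
  forall e : R, 0 < e -> exists2 eta : R, 0 < eta &
  forall s : seq (R * R),
    (forall I, I \in s -> a <= I.1 /\ I.1 <= I.2 /\ I.2 <= b) ->
    pairwise (fun I J : R * R => (I.2 <= J.1) || (J.2 <= I.1)) s ->
    \sum_(I <- s) (I.2 - I.1) < eta ->
    \sum_(I <- s) `|phi I.2 - phi I.1| < e.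

(* On the unbounded domain [0, +oo[ absolute continuity is understood, as
   usual, on every compact subinterval. *)
Definition abs_cont phi : Prop := forall b : R, 0 < b -> abs_cont_on phi 0 b.

Definition pnorm d (p : R) (z : d.-tuple R) : R :=
  (\sum_(i < d) `|tnth z i| `^ p) `^ p^-1.

Definition gamma (d : nat) (p alpha : R) : R :=
  Num.min 1 (d%:R `^ ((2 - p - alpha) / p)) *
  (1 - alpha * ((d%:R - 1) / (d%:R - 2))).

Definition phi_bound (d : nat) (p alpha : R) : R :=
  2 * (d%:R - 2) * gamma d p alpha.

Definition g_phi (d n : nat) (p alpha : R) phi (u : R) : R :=
  let c := d%:R - 2 - alpha * (d%:R - 1) in
  u `^ c * phi u /
  (phi_bound d p alpha - phi u) `^ (1 + 2 * c / (n%:R + 2)).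

Definition sigma2_hat (n : nat) (s : R) : R := s / (n%:R + 2).

(* Where some z_i vanishes or s <= 0 the value is conventional (x / 0 = 0, and
   Num.sqrt is 0 on negative numbers); that event is null in the model. *)
Definition theta_hat (d n : nat) (p alpha : R) phi (z : d.-tuple R) (s : R) :
    d.-tuple R :=
  [tuple (1 - sigma2_hat n s * phi (pnorm p z / Num.sqrt (sigma2_hat n s)) /
              (pnorm p z `^ (2 - alpha) * `|tnth z i| `^ alpha)) * tnth z i
   | i < d].

End shrinkage.

(* Main.v *)
From HB Require Import structures.
Require Import Defs.
From mathcomp Require Import all_boot all_order all_algebra.
From mathcomp Require Import all_classical all_reals all_analysis.
From mathcomp Require Import measurable_realfun ring lra.

(** Both halves of minimaxity compare the maximal risk with d.

    No estimator does better than d.  Take v = 1 and put on theta the prior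
    N(0, tau I).  Given the data, each theta_j is normal with variance
    tau / (1 + tau), whatever else is observed, so a coordinate of any
    estimator has Bayes risk at least tau / (1 + tau)  (bayes_normal1,
    bayes_coord); the maximal risk is at least d tau / (1 + tau), which tends
    to d  (max_risk_ge).

    The shrinkage estimator has risk at most d.  Write S = v |w|^2 with w
    standard normal.  Stein's identity, applied to each z_i in the linear term
    of the loss and to each w_j in the quadratic term, turns the loss into
    d + D plus a function of mean zero, where D contains phi and phi'.  It
    remains to see D <= 0 pointwise.  With h = |z|_p the weights
    x_i = (|z_i| / h)^p sum to 1 and the factors b_i = x_i^(-a/p) (a is alpha)
    decrease in x_i, so Chebyshev's sum inequality bounds both sums of D by
    the mean of the b_i: sum_i b_i x_i is at most that mean, and
    sum_i b_i x_i^((2-a)/p) at most that mean over min(1, d^((2-p-a)/p)).  In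
    the variable t = ln u, with c = d - 2 - a (d - 1), M the upper bound on
    phi, f = phi(e^t) and f' its derivative in t, what is left is
    f' (M + 2 c f / (n + 2)) + c f (M - f) >= 0; this is the sign of the
    logarithmic derivative of g_phi, hence a hypothesis
    (shrinkage_drift_le0).

    Two things have to be made rigorous.  First, phi' exists only almost
    everywhere and carries no bound, and the estimator is singular where z_i or
    s vanishes.  So |z_i| is replaced by sqrt(z_i^2 + e), s by s + e inside
    phi and by s / (1 + e s) in front of it, and phi(e^t) by its average over
    a window of length e in t.  Averaging keeps the differential inequality
    exactly: it says f' >= - H(f) for the function
    H(x) = c x (M - x) / (M + 2 c x / (n + 2)), which is concave
    (drift_tangent), so Jensen's inequality applies.  To avoid differentiating
    phi, the inequality is first read off the monotonicity of g_phi as a bound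
    on finite differences (log_derivative_drop), and then averaged
    (smooth_profile).  Every regularised estimator has risk at most d
    (regularised_risk_le), they converge everywhere to the given one
    (cvg_regularised), and Fatou's lemma concludes.

    Second, one-dimensional identities are to be used in a single coordinate
    of a product law.  The tool is resampling: replacing one coordinate by an
    independent draw from its own law does not change the joint law
    (resampled_product_law), so integrals may be computed with that coordinate
    integrated first. *)

Set Implicit Arguments.
Unset Strict Implicit.
Unset Printing Implicit Defensive.
Import Order.TTheory GRing.Theory Num.Theory.
Import numFieldNormedType.Exports.
Local Open Scope classical_set_scope.
Local Open Scope ring_scope.

(** * The normal law on the line and Stein's identity *)

Section normal1.
Context {R : realType}.
Implicit Types (m v : R).
Local Notation mu := (@lebesgue_measure R).

(** The Radon-Nikodym derivative of the law is known only almost everywhere;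
    this exchanges it for the explicit density. *)
Lemma ge0_integral_normal1 m v (f : R -> \bar R) :
  measurable_fun [set: R] f -> (forall x, (0 <= f x)%E) ->
  (\int[normal1 m v]_x f x =
   \int[mu]_x (f x * (normal_pdf m (Num.sqrt v) x)%:E))%E.
Proof.
move=> mf f0; rewrite ge0_integral_distribution//=.
set s := Num.sqrt v; set nu := normal_prob m s.
have numu : nu `<< mu by exact: normal_prob_dominates.
rewrite -(Radon_Nikodym_SigmaFinite.change_of_variables numu)//=.
set g := Radon_Nikodym_SigmaFinite.f nu mu.
have ig : mu.-integrable setT g by exact: Radon_Nikodym_SigmaFinite.f_integrable.
apply: ae_eq_integral => //.
- by apply: emeasurable_funM => //; exact: measurable_int ig.
- apply: emeasurable_funM => //.
  by apply/measurable_EFinP; exact: measurable_normal_pdf.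
have gp : ae_eq mu setT g (fun x => (normal_pdf m s x)%:E).
  apply: integral_ae_eq => //.
  - by apply/measurable_EFinP; exact: measurable_normal_pdf.
  - by move=> E _ mE; rewrite -Radon_Nikodym_SigmaFinite.f_integral.
by apply: filterS gp => x /= + _ => -> //.
Qed.

Lemma normal_pdfvE m v x : 0 < v -> normal_pdf m (Num.sqrt v) x =
  normal_peak (Num.sqrt v) * expR (- (x - m) ^+ 2 / (2 * v)).
Proof.
move=> v0; rewrite normal_pdfE ?gt_eqF ?sqrtr_gt0// /normal_fun.
by rewrite sqr_sqrtr ?ltW// mulr2n; congr (_ * expR (_ / _)); ring.
Qed.

(** Spending half of the Gaussian exponent absorbs quadratic growth. Both
    integrability and the vanishing of boundary terms below rest on this. *)
Lemma sqr_normal_pdf_le m v : 0 < v -> exists2 C : R, 0 < C & forall x,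
  (1 + (x - m) ^+ 2) * normal_pdf m (Num.sqrt v) x <=
  C * expR (- (x - m) ^+ 2 / (4 * v)).
Proof.
move=> v0; set k := normal_peak (Num.sqrt v).
have k0 : 0 < k by apply: normal_peak_gt0; rewrite gt_eqF ?sqrtr_gt0.
(* 1 contributes C = k, and q exp (- q / 4 v) <= 4 v gives the rest. *)
exists ((1 + 4 * v) * k); first by rewrite mulr_gt0//; lra.
move=> x; rewrite normal_pdfvE// -/k; set q := (x - m) ^+ 2.
have q0 : 0 <= q by rewrite sqr_ge0.
set e := expR (- q / (4 * v)).
have e0 : 0 < e by exact: expR_gt0.
have -> : expR (- q / (2 * v)) = e * e.
  by rewrite /e -expRD; congr expR; field; rewrite gt_eqF.
have e1 : e <= 1.
  by rewrite -expR0 ler_expR mulNr oppr_le0 divr_ge0//; lra.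
have qe : q * e <= 4 * v.
  have : 1 + q / (4 * v) <= expR (q / (4 * v)) by exact: expR_ge1Dx.
  have -> : expR (q / (4 * v)) = e^-1 by rewrite /e mulNr expRN invrK.
  move=> h; have : q / (4 * v) <= e^-1 by lra.
  rewrite ler_pdivrMr; last by lra.
  by rewrite mulrC ler_pdivlMr.
have -> : (1 + q) * (k * (e * e)) = (e + q * e) * (k * e) by ring.
rewrite -[leRHS]mulrA ler_wpM2r//; last lra.
by rewrite mulr_ge0// ltW.
Qed.

(** By sqr_normal_pdf_le the integrand is dominated by a multiple of the
    density with variance 2 v. *)
Lemma normal1_integrable_le m v (f : R -> R) C : 0 < v ->
  measurable_fun [set: R] f ->
  (forall x, `|f x| <= C * (1 + (x - m) ^+ 2)) ->
  mu.-integrable setT (fun x => (f x * normal_pdf m (Num.sqrt v) x)%:E).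
Proof.
move=> v0 mf fC; have [D D0 pD] := sqr_normal_pdf_le m v0.
have C0 : 0 <= C.
  have := fC m; rewrite subrr expr0n /= addr0 mulr1; exact: le_trans.
set k' := normal_peak (Num.sqrt (2 * v)).
have v20 : 0 < 2 * v by lra.
have k0 : 0 < k' by apply: normal_peak_gt0; rewrite gt_eqF ?sqrtr_gt0.
apply: (@le_integrable _ _ _ mu setT measurableT _
  (fun x => ((C * D / k')%:E * (normal_pdf m (Num.sqrt (2 * v)) x)%:E)%E)).
- apply/measurable_EFinP; apply: measurable_funM => //.
  exact: measurable_normal_pdf.
- move=> x _; rewrite -EFinM !abse_EFin lee_fin.
  have p0 := normal_pdf_ge0 m (Num.sqrt v) x.
  have c0 : 0 <= C * D / k' by apply: divr_ge0 (mulr_ge0 C0 (ltW D0)) (ltW k0).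
  rewrite [leRHS]ger0_norm; last by apply: mulr_ge0 => //; exact: normal_pdf_ge0.
  rewrite normrM (ger0_norm p0).
  apply: (le_trans (ler_wpM2r p0 (fC x))).
  rewrite -[leLHS]mulrA; apply: (le_trans (ler_wpM2l C0 (pD x))).
  rewrite normal_pdfvE// -/k' [2 * (2 * v)](_ : _ = 4 * v); last by ring.
  by rewrite le_eqVlt; apply/orP; left; apply/eqP; field; rewrite gt_eqF.
- by apply: integrableZl => //; exact: integrable_normal_pdf.
Qed.

Lemma integrable_normal1 m v (f : R -> R) C : 0 < v ->
  measurable_fun [set: R] f ->
  (forall x, `|f x| <= C * (1 + (x - m) ^+ 2)) ->
  (normal1 m v).-integrable setT (EFin \o f).
Proof.
move=> v0 mf fC; apply/integrableP; split; first exact/measurable_EFinP.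
rewrite ge0_integral_normal1//; last by apply/measurable_EFinP/measurableT_comp.
have /integrableP[_] := normal1_integrable_le v0 mf fC.
apply: le_lt_trans; apply: ge0_le_integral => //.
- by move=> x _; rewrite mule_ge0// lee_fin normal_pdf_ge0.
- apply: emeasurable_funM.
    by apply/measurable_EFinP/measurableT_comp.
  by apply/measurable_EFinP; exact: measurable_normal_pdf.
- apply/measurable_EFinP/measurableT_comp => //; apply: measurable_funM => //.
  exact: measurable_normal_pdf.
- move=> x _; rewrite /= -EFinM normrM lee_fin.
  by rewrite (ger0_norm (normal_pdf_ge0 _ _ _)).
Qed.

Lemma integral_normal1 m v (f : R -> R) C : 0 < v ->
  measurable_fun [set: R] f ->
  (forall x, `|f x| <= C * (1 + (x - m) ^+ 2)) ->
  (\int[normal1 m v]_x (f x)%:E =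
   \int[mu]_x (f x * normal_pdf m (Num.sqrt v) x)%:E)%E.
Proof.
move=> v0 mf fC; have mp := measurable_normal_pdf m (Num.sqrt v).
rewrite [LHS]integralE [RHS]integralE; congr (_ - _)%E.
- rewrite ge0_integral_normal1//; last first.
    by apply/measurable_funepos/measurable_EFinP.
  apply: eq_integral => x _; rewrite !funeposE -!EFin_max -EFinM.
  by rewrite maxr_pMl ?normal_pdf_ge0// mul0r.
- rewrite ge0_integral_normal1//; last first.
    by apply/measurable_funeneg/measurable_EFinP.
  apply: eq_integral => x _; rewrite !funenegE -!EFinN -!EFin_max -EFinM.
  by rewrite maxr_pMl ?normal_pdf_ge0// mul0r mulNr.
Qed.

Lemma is_derive_normal_pdf m v (x : R) : 0 < v ->
  is_derive x 1 (normal_pdf m (Num.sqrt v))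
    (- ((x - m) / v) * normal_pdf m (Num.sqrt v) x).
Proof.
move=> v0; set k := normal_peak (Num.sqrt v).
have -> : normal_pdf m (Num.sqrt v) =
    (fun x => k * expR (- (x - m) ^+ 2 / (2 * v))).
  by apply/funext => y; rewrite normal_pdfvE.
apply: is_derive_eq; rewrite /GRing.scale /=.
by field; rewrite gt_eqF.
Qed.

Lemma cvg_integral_itv m (g : R -> R) :
  mu.-integrable setT (EFin \o g) ->
  (\int[mu]_(x in `[(m - k.+1%:R)%R, (m + k.+1%:R)%R]) (g x)%:E)%E @[k --> \oo] -->
  (\int[mu]_x (g x)%:E)%E.
Proof.
move=> ig.
pose g_ (k : nat) (x : R) : \bar R :=
  ((EFin \o g) \_ `[m - k.+1%:R, m + k.+1%:R]) x.
have mg := measurable_int _ ig.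
have mg_ k : measurable_fun setT (g_ k).
  by apply: (measurable_restrictT _ _).1 => //; exact: measurable_funTS.
have cg_ : {ae mu, forall x, setT x -> g_ ^~ x @ \oo --> (g x)%:E}.
  apply: aeW => x _; apply: cvg_near_cst.
  exists (Num.truncn `|x - m|) => // k /= hk.
  rewrite /g_ patchE ifT// inE /= in_itv /= -ler_distl.
  by rewrite ltW// (lt_le_trans (truncnS_gt _))// ler_nat.
have ig2 : mu.-integrable setT (abse \o (EFin \o g)) by exact: integrable_abse.
have [] := @dominated_convergence _ _ _ mu setT measurableT g_ (EFin \o g)
  (abse \o (EFin \o g)) mg_ mg cg_ ig2.
  apply: aeW => x k _; rewrite /g_ patchE; case: ifPn => // _.
  by rewrite abse0; exact: abse_ge0.
move=> _ _; under eq_fun do rewrite -integral_mkcond.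
by [].
Qed.

(** The density p satisfies v p' = - (x - m) p, so ((x - m) f - v f') p is the
    derivative of - v f p, which vanishes at infinity; integration over
    growing intervals gives the identity without any improper integral. *)
Lemma stein_normal1 m v (f df : R -> R) C : 0 < v ->
  (forall x : R, is_derive x 1 f (df x)) -> continuous df ->
  (forall x, `|f x| <= C * (1 + (x - m) ^+ 2)) ->
  (forall x, `|(x - m) * f x| <= C * (1 + (x - m) ^+ 2)) ->
  (forall x, `|df x| <= C * (1 + (x - m) ^+ 2)) ->
  (\int[normal1 m v]_x ((x - m) * f x)%:E =
   v%:E * \int[normal1 m v]_x (df x)%:E)%E.
Proof.
move=> v0 fdf cdf fC xfC dfC.
set p := normal_pdf m (Num.sqrt v).
have cf : continuous f.
  by move=> x; apply: differentiable_continuous; apply/derivable1_diffP; case: (fdf x).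
have mf : measurable_fun setT f by exact: continuous_measurable_fun.
have mdf : measurable_fun setT df by exact: continuous_measurable_fun.
have mxm : measurable_fun setT (fun x : R => x - m) by exact: measurable_funB.
have mxf : measurable_fun setT (fun x : R => (x - m) * f x) by exact: measurable_funM.
have idf := normal1_integrable_le v0 mdf dfC.
have ixf := normal1_integrable_le v0 mxf xfC.
rewrite (integral_normal1 v0 mxf xfC) (integral_normal1 v0 mdf dfC) -/p.
set I1 := (\int[mu]_x _)%E; set I2 := (\int[mu]_x _)%E.
have f1 : I1 \is a fin_num by exact: integrable_fin_num.
have f2 : I2 \is a fin_num by exact: integrable_fin_num.
suff : (I1 - v%:E * I2 = 0)%E.
  by rewrite -(fineK f1) -(fineK f2) -EFinM -EFinB => -[] /subr0_eq ->.
rewrite /I1 /I2 -integralZl//.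
rewrite -integralB//; last exact: integrableZl.
pose g x := ((x - m) * f x - v * df x) * p x.
rewrite (_ : (fun x => _) = EFin \o g); last first.
  by apply/funext => x; rewrite /g /=; congr EFin; ring.
have ig : mu.-integrable setT (EFin \o g).
  rewrite (_ : EFin \o g = (fun x => ((x - m) * f x * p x)%:E - v%:E * (df x * p x)%:E)%E).
    by apply: integrableB => //; exact: integrableZl.
  by apply/funext => x; rewrite /g /=; congr EFin; ring.
have := @cvg_integral_itv m g ig.
(* F is the primitive of the integrand g found by the product rule. *)
pose F x := - v * (f x * p x).
have dF (x : R) : is_derive x 1 F (g x).
  have pd := is_derive_normal_pdf m x v0.
  apply: is_derive_eq; rewrite /GRing.scale /= /g -/p.
  by field; rewrite gt_eqF.
have cp : continuous p by apply: continuous_normal_pdf; rewrite gt_eqF ?sqrtr_gt0.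
have cg : continuous g.
  move=> x; apply: cvgM; last exact: cp.
  apply: cvgB; apply: cvgM; [apply: cvgB; [exact: cvg_id|exact: cvg_cst]|exact: cf
    |exact: cvg_cst|exact: cdf].
have FTC k : (\int[mu]_(x in `[(m - k.+1%:R)%R, (m + k.+1%:R)%R]) (g x)%:E =
   (F (m + k.+1%:R))%:E - (F (m - k.+1%:R))%:E)%E.
  have ab : m - k.+1%:R < m + k.+1%:R.
    by have := ltr0Sn R k; lra.
  have cF : continuous F.
    by move=> x; apply: differentiable_continuous; apply/derivable1_diffP; case: (dF x).
  apply: continuous_FTC2 => //.
  - by apply: continuous_subspaceT.
  - split; [by move=> x _; case: (dF x) | exact/cvg_at_right_filter/cF
    | exact/cvg_at_left_filter/cF].
  - by move=> x _; rewrite derive1E; case: (dF x) => _ ->.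
under eq_fun do rewrite FTC.
have [D D0 pD] := sqr_normal_pdf_le m v0.
have C0 : 0 <= C.
  have := fC m; rewrite subrr expr0n /= addr0 mulr1; exact: le_trans.
pose K := v * (C * (D * (4 * v))).
have K0 : 0 <= K.
  have v40 : 0 <= 4 * v by lra.
  by rewrite /K; exact: mulr_ge0 (ltW v0) (mulr_ge0 C0 (mulr_ge0 (ltW D0) v40)).
(* At distance y from the mean the boundary term is at most K / y. *)
have Fle x y : 1 <= y -> (x - m) ^+ 2 = y ^+ 2 -> `|F x| <= K * y^-1.
  move=> y1 xy; have y0 : 0 < y by lra.
  have p0 : 0 <= p x by exact: normal_pdf_ge0.
  rewrite /F normrM normrN (gtr0_norm v0) normrM (ger0_norm p0) /K -!mulrA.
  rewrite ler_pM2l//; apply: (le_trans (ler_wpM2r p0 (fC x))).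
  rewrite -!mulrA ler_wpM2l//; apply: (le_trans (pD x)); rewrite ler_pM2l//.
  rewrite xy mulNr expRN; set a := y ^+ 2 / (4 * v).
  have a0 : 0 < a by rewrite divr_gt0 ?exprn_gt0//; lra.
  have aE : a <= expR a by have := expR_ge1Dx a; lra.
  apply: (@le_trans _ _ a^-1); first by rewrite lef_pV2 ?posrE ?expR_gt0.
  rewrite /a invf_div mulrA ler_wpM2l//; first lra.
  by rewrite lef_pV2 ?posrE ?exprn_gt0// expr2 ler_peMl// ltW.
have F0 : (F (m + k.+1%:R) - F (m - k.+1%:R)) @[k --> \oo] --> (0 : R).
  have K0' (r : R) : (r * harmonic k) @[k --> \oo] --> (0 : R).
    by rewrite -[X in _ --> X](mulr0 r); apply: cvgMr; exact: cvg_harmonic.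
  apply: (squeeze_cvgr _ (K0' (- (2 * K))) (K0' (2 * K))).
  near=> k; rewrite mulNr -ler_norml.
  apply: (le_trans (ler_normB _ _)); rewrite mulrDl mul1r mulrDl.
  by apply: lerD; apply: Fle; rewrite ?ler1n//; ring.
move=> cG; apply: (cvg_unique _ cG) => //.
by apply: cvg_EFin; [exact: nearW|exact: F0].
Unshelve. all: by end_near. Qed.

Lemma ler_norm_1Dsqr (y : R) : `|y| <= 1 + y ^+ 2.
Proof.
have := sqr_ge0 (y - 1 / 2); have := sqr_ge0 (y + 1 / 2).
by rewrite !sqrrD ler_norml => *; apply/andP; split; lra.
Qed.

(** Stein's identity for f x = x - m; the next lemma takes a constant f. *)
Lemma integral_normal1_sqr m v : 0 < v ->
  (\int[normal1 m v]_x ((x - m) ^+ 2)%:E = v%:E)%E.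
Proof.
move=> v0; have h (x : R) : 0 <= (x - m) ^+ 2 by exact: sqr_ge0.
have := @stein_normal1 m v (fun x => x - m) (cst 1) 1 v0.
have -> : (\int[normal1 m v]_x (cst 1 x : R)%:E = 1)%E.
  by rewrite (integral_cst (normal1 m v) measurableT 1%:E) mul1e; exact: probability_setT.
rewrite mule1 => st; apply: st.
- by move=> x; apply: is_derive_eq; rewrite subr0.
- by move=> x; exact: cvg_cst.
- by move=> x; rewrite mul1r ler_norm_1Dsqr.
- by move=> x; rewrite mul1r -expr2 ger0_norm// lerDr.
- by move=> x; rewrite normr1 mul1r lerDl.
Qed.

Lemma integral_normal1_id m v : 0 < v ->
  (\int[normal1 m v]_x (x - m)%:E = 0)%E.
Proof.
move=> v0; have h (x : R) : 0 <= (x - m) ^+ 2 by exact: sqr_ge0.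
have := @stein_normal1 m v (cst 1) (cst 0) 1 v0.
rewrite integral0 mule0 => st.
rewrite -[RHS]st.
- by apply: eq_integral => x _; rewrite mulr1.
- by move=> x; exact: cvg_cst.
- by move=> x; rewrite normr1 mul1r lerDl.
- by move=> x; rewrite mul1r mulr1 ler_norm_1Dsqr.
- by move=> x; rewrite normr0 mul1r addr_ge0.
Qed.

End normal1.

(** * Bayes risk of one normal coordinate *)

Section bayes1.
Context {R : realType}.
Implicit Types (m v a : R).
Local Notation mu := (@lebesgue_measure R).

Definition translate a : measurableTypeR R -> measurableTypeR R :=
  fun x => a + x.

Lemma measurable_translate a :
  measurable_fun [set: measurableTypeR R] (translate a).
Proof. exact: measurable_funD. Qed.

HB.instance Definition _ a :=
  isMeasurableFun.Build _ _ _ _ (translate a) (@measurable_translate a).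

Lemma lebesgue_measure_translate a (A : set R) : measurable A ->
  pushforward mu (translate a) A = mu A.
Proof.
move=> mA; apply/esym/lebesgue_measure_unique => //= _ [[x y]] _ <-.
rewrite /pushforward.
rewrite (_ : _ @^-1` _ = `]x - a, y - a]%classic); last first.
  by apply/seteqP; split=> z /=; rewrite /translate !in_itv/= ltrBlDl lerBrDl.
rewrite !lebesgue_measure_itv/= !lte_fin ltrD2r; case: ifP => // _.
by rewrite -!EFinB; congr EFin; ring.
Qed.

Lemma ge0_integral_lebesgue_translate a (f : R -> \bar R) :
  measurable_fun [set: R] f -> (forall x, (0 <= f x)%E) ->
  (\int[mu]_x f x = \int[mu]_x f (a + x)%R)%E.
Proof.
move=> mf f0.
have := @ge0_integral_pushforward _ _ _ _ R (translate a) (@measurable_translate a) mu setT f.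
rewrite preimage_setT => <-//.
by apply: eq_measure_integral => //= A mA _; exact/esym/lebesgue_measure_translate.
Qed.

Lemma ge0_integral_normal1_translate m v a (f : R -> \bar R) : 0 < v ->
  measurable_fun [set: R] f -> (forall x, (0 <= f x)%E) ->
  (\int[normal1 (a + m) v]_x f x = \int[normal1 m v]_x f (a + x)%R)%E.
Proof.
move=> v0 mf f0; have mfa : measurable_fun setT (fun x : R => f (a + x)).
  by apply: measurableT_comp => //; exact: measurable_funD.
have E1 := @ge0_integral_normal1 R (a + m) v f mf f0.
have E2 := @ge0_integral_normal1 R m v _ mfa (fun x => f0 _).
apply: (etrans E1); apply/esym; apply: (etrans E2); apply/esym.
apply: (etrans (@ge0_integral_lebesgue_translate a _ _ _)).
- apply: emeasurable_funM => //; apply/measurable_EFinP.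
  exact: measurable_normal_pdf.
- by move=> x; rewrite mule_ge0// lee_fin normal_pdf_ge0.
- apply: eq_integral => x _; congr (_ * _%:E)%E; rewrite !normal_pdfvE//.
  by rewrite [a + x - _](_ : _ = x - m)//; ring.
Qed.

(** Expanding around the mean m, the excess over the variance is (a - m)^2. *)
Lemma integral_normal1_dev_ge m v a : 0 < v ->
  (v%:E <= \int[normal1 m v]_x ((a - x) ^+ 2)%:E)%E.
Proof.
move=> v0.
have mxm : measurable_fun setT (fun x : R => x - m) by exact: measurable_funB.
have i1 : (normal1 m v).-integrable setT (fun x => ((x - m) ^+ 2)%:E).
  apply: (@integrable_normal1 _ _ _ _ 1) => //; first exact: measurable_funX.
  by move=> x; rewrite mul1r ger0_norm ?sqr_ge0// lerDr.
have i2 : (normal1 m v).-integrable setT (fun x => (x - m)%:E).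
  apply: (@integrable_normal1 _ _ _ _ 1) => //.
  by move=> x; rewrite mul1r ler_norm_1Dsqr.
have i3 : (normal1 m v).-integrable setT (fun x => ((-2 * (a - m))%:E * (x - m)%:E)%E).
  exact: integrableZl.
have i4 : (normal1 m v).-integrable setT (fun x => ((a - x) ^+ 2)%:E).
  apply: (@integrable_normal1 _ _ _ _ (2 * (1 + (a - m) ^+ 2))) => //.
    by apply: measurable_funX; exact: measurable_funB.
  move=> x; rewrite ger0_norm ?sqr_ge0//.
  have := sqr_ge0 ((a - m) + (x - m)); have := mulr_ge0 (sqr_ge0 (a - m)) (sqr_ge0 (x - m)).
  rewrite !expr2; nra.
apply: (@le_trans _ _ (\int[normal1 m v]_x (((x - m) ^+ 2)%:E + (-2 * (a - m))%:E * (x - m)%:E))%E).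
  by rewrite integralD// integralZl// integral_normal1_sqr// integral_normal1_id// mule0 adde0.
apply: le_integral => //; first exact: integrableD.
move=> x _; rewrite -EFinM -EFinD lee_fin.
by have := sqr_ge0 (a - m); rewrite !expr2; lra.
Qed.

(** Prior times likelihood equals marginal times posterior: completing the
    square in th gives the posterior mean tau / (1 + tau) z and variance tau /
    (1 + tau). *)
Lemma normal_pdf_bayes (tau th z : R) : 0 < tau ->
  normal_pdf th (Num.sqrt 1) z * normal_pdf 0 (Num.sqrt tau) th =
  normal_pdf 0 (Num.sqrt (1 + tau)) z *
  normal_pdf (tau / (1 + tau) * z) (Num.sqrt (tau / (1 + tau))) th.
Proof.
move=> t0; have t1 : 0 < 1 + tau by lra.
have r0 : 0 < tau / (1 + tau) by exact: divr_gt0.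
rewrite !normal_pdfvE// mulrACA [RHS]mulrACA -!expRD; congr (_ * expR _); last first.
  by field; rewrite !gt_eqF.
rewrite /normal_peak -!invfM; congr (_^-1).
rewrite !sqr_sqrtr ?ltW//.
have p0 : 0 < (pi : R) by exact: pi_gt0.
rewrite -!sqrtrM; last 2 first.
- by rewrite mulrn_wge0// mulr_ge0// ltW.
- by rewrite mulrn_wge0// mulr_ge0// ltW.
by congr Num.sqrt; field; rewrite gt_eqF.
Qed.

(** Conditionally on the observation z = th + x the estimate D z is a
    constant, and no constant predicts th better than its posterior mean. *)
Lemma bayes_normal1 (tau : R) (D : R -> R) : 0 < tau ->
  measurable_fun setT D ->
  ((tau / (1 + tau))%:E <=
   \int[normal1 0 tau]_th \int[normal1 0 1]_x ((D (th + x)%R - th) ^+ 2)%:E)%E.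
Proof.
move=> t0 mD; have t1 : 0 < 1 + tau by lra.
have r0 : 0 < tau / (1 + tau) by exact: divr_gt0.
pose M := measurableTypeR R.
pose q (th z : R) : R := (D z - th) ^+ 2.
have mq (th : R) : measurable_fun setT (q th).
  by apply: measurable_funX; exact: measurable_funB.
have q0 th z : 0 <= q th z by exact: sqr_ge0.
pose F (tz : M * M) : \bar R :=
  (q tz.1 tz.2 * normal_pdf tz.1 (Num.sqrt 1) tz.2 *
   normal_pdf 0 (Num.sqrt tau) tz.1)%:E.
have mF : measurable_fun setT F.
  apply/measurable_EFinP; apply: measurable_funM; last first.
    apply: (measurableT_comp (f := normal_pdf 0 (Num.sqrt tau))) => //.
    exact: measurable_normal_pdf.
  apply: measurable_funM.
    by apply: measurable_funX; apply: measurable_funB => //; exact: (measurableT_comp mD).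
  apply: (eq_measurable_fun (fun tz : M * M => normal_peak (Num.sqrt 1) *
     expR (- (tz.2 - tz.1) ^+ 2 / (2 * 1)))).
    by move=> tz _; rewrite normal_pdfvE.
  apply: measurable_funM => //; apply: measurableT_comp => //.
  apply: measurable_funM => //; apply: measurableT_comp => //.
  by apply: measurable_funX; exact: measurable_funB.
have F0 tz : (0 <= F tz)%E.
  by rewrite lee_fin mulr_ge0 ?normal_pdf_ge0// mulr_ge0 ?normal_pdf_ge0.
have mG : measurable_fun [set: R * R] (fun tx => ((D (tx.1 + tx.2) - tx.1) ^+ 2)%:E).
  apply/measurable_EFinP; apply: measurable_funX; apply: measurable_funB => //.
  by apply: (measurableT_comp mD); exact: measurable_funD.
(* Substituting z = th + x makes the estimate independent of th. *)
have E1 : (\int[normal1 0 tau]_th \int[normal1 0 1]_x ((D (th + x)%R - th) ^+ 2)%:E =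
    \int[mu]_th \int[mu]_z F (th, z))%E.
  have G0 th : (0 <= \int[normal1 0 1]_x ((D (th + x)%R - th) ^+ 2)%:E)%E.
    by apply: integral_ge0 => x _; rewrite lee_fin sqr_ge0.
  have mGF : measurable_fun setT (fun th : R => \int[normal1 0 1]_x ((D (th + x)%R - th) ^+ 2)%:E)%E.
    apply: (measurable_fun_fubini_tonelli_F (m2 := normal1 0 1)
      (fun tx : R * R => ((D (tx.1 + tx.2)%R - tx.1) ^+ 2)%:E)) => //.
    by move=> tx; rewrite lee_fin sqr_ge0.
  apply: (etrans (@ge0_integral_normal1 _ _ _ _ mGF G0)).
  apply: eq_integral => th _.
  have mqE : measurable_fun setT (fun z : R => (q th z)%:E) by exact/measurable_EFinP.
  have qE0 z : (0 <= (q th z)%:E)%E by rewrite lee_fin.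
  have := @ge0_integral_normal1_translate 0 1 th _ ltr01 mqE qE0.
  rewrite addr0 => <-.
  have E := @ge0_integral_normal1 _ th 1 _ mqE qE0; rewrite E.
  rewrite -ge0_integralZr//.
  - apply: (emeasurable_funM mqE); apply/measurable_EFinP.
    exact: measurable_normal_pdf.
  - by move=> z _; rewrite mule_ge0 ?lee_fin ?normal_pdf_ge0.
  - by rewrite lee_fin normal_pdf_ge0.
rewrite E1 (fubini_tonelli F mF F0).
set rho := tau / (1 + tau).
apply: (@le_trans _ _ (\int[mu]_z (rho%:E * (normal_pdf 0 (Num.sqrt (1 + tau)) z)%:E)))%E.
  rewrite ge0_integralZl//=.
  - by rewrite integral_normal_pdf mule1.
  - by apply/measurable_EFinP; exact: measurable_normal_pdf.
  - by move=> z _; rewrite lee_fin normal_pdf_ge0.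
  - by rewrite lee_fin ltW.
apply: ge0_le_integral => //.
- by move=> z _; rewrite mule_ge0// lee_fin ?normal_pdf_ge0// ltW.
- by apply: emeasurable_funM => //; apply/measurable_EFinP; exact: measurable_normal_pdf.
- exact: (measurable_fun_fubini_tonelli_G (m1 := mu) F).
move=> z _.
have qE0 th : (0 <= (q th z)%:E)%E by rewrite lee_fin.
have mqz : measurable_fun setT (fun th : R => (q th z)%:E).
  by apply/measurable_EFinP; apply: measurable_funX; exact: measurable_funB.
(* For fixed z the weight in th is the marginal density times the posterior. *)
have E2 : (\int[mu]_th F (th, z) = (normal_pdf 0 (Num.sqrt (1 + tau)) z)%:E *
   \int[normal1 (rho * z)%R rho]_th (q th z)%:E)%E.
  have E := @ge0_integral_normal1 _ (rho * z)%R rho _ mqz qE0.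
  apply: (etrans _ (congr1 (fun i => _ * i)%E (esym E))).
  apply/esym; apply: (etrans (esym (ge0_integralZl mu measurableT _ _ _))).
  - apply: (emeasurable_funM mqz); apply/measurable_EFinP.
    exact: measurable_normal_pdf.
  - by move=> th _; rewrite mule_ge0 ?lee_fin ?normal_pdf_ge0.
  - by rewrite lee_fin normal_pdf_ge0.
  apply: eq_integral => th _; rewrite /F -!EFinM; congr EFin.
  by rewrite /= -[RHS]mulrA normal_pdf_bayes//; ring.
rewrite [leRHS]E2 muleC; apply: lee_wpmul2l; first by rewrite lee_fin normal_pdf_ge0.
exact: integral_normal1_dev_ge.
Qed.
End bayes1.

(** * Resampling one coordinate *)

Section resampling.
Context {R : realType}.

(** One step of Gibbs sampling: up overwrites some coordinate of x by t, and
    pi is invariant when t is drawn from mu independently of x. Stated on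
    nonnegative functions, so that it composes with Tonelli's theorem. *)
Definition resampled d (T : measurableType d) (pi : probability T R)
    (mu : probability R R) (up : T * R -> T) : Prop :=
  measurable_fun setT up /\
  forall f : T -> \bar R, measurable_fun setT f -> (forall x, (0 <= f x)%E) ->
  (\int[pi]_x f x = \int[pi]_x \int[mu]_t f (up (x, t)))%E.

Lemma resampled_pairl d1 d2 (T1 : measurableType d1) (T2 : measurableType d2)
    (pi1 : probability T1 R) (pi2 : probability T2 R) mu up :
  resampled pi1 mu up ->
  resampled (pi1 \x pi2)%E mu (fun xyt => (up (xyt.1.1, xyt.2), xyt.1.2)).
Proof.
move=> [mup rup].
have mup2 : measurable_fun [set: (T1 * T2) * R]
    (fun xyt => (up (xyt.1.1, xyt.2), xyt.1.2)).
  apply: measurable_fun_pair; last exact: (measurableT_comp measurable_snd measurable_fst).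
  apply: (measurableT_comp mup); apply: measurable_fun_pair => //.
  exact: (measurableT_comp measurable_fst measurable_fst).
split=> // f mf f0.
have mG : measurable_fun setT (fun xy : T1 * T2 => \int[mu]_t f (up (xy.1, t), xy.2))%E.
  apply: (measurable_fun_fubini_tonelli_F (m2 := mu)
    (fun xyt : (T1 * T2) * R => f (up (xyt.1.1, xyt.2), xyt.1.2))) => //.
  exact: (measurableT_comp mf mup2).
rewrite (fubini_tonelli2 f)// (fubini_tonelli2 _ mG)/=; last first.
  by move=> xy; exact: integral_ge0.
apply: eq_integral => y _; rewrite /fubini_G /=.
rewrite (rup (fun x => f (x, y)))//.
by apply: (measurableT_comp mf); exact: measurable_pair2.
Qed.

Lemma resampled_pairr d1 d2 (T1 : measurableType d1) (T2 : measurableType d2)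
    (pi1 : probability T1 R) (pi2 : probability T2 R) mu up :
  resampled pi2 mu up ->
  resampled (pi1 \x pi2)%E mu (fun xyt => (xyt.1.1, up (xyt.1.2, xyt.2))).
Proof.
move=> [mup rup].
have mup2 : measurable_fun [set: (T1 * T2) * R]
    (fun xyt => (xyt.1.1, up (xyt.1.2, xyt.2))).
  apply: measurable_fun_pair; first exact: (measurableT_comp measurable_fst measurable_fst).
  apply: (measurableT_comp mup); apply: measurable_fun_pair => //.
  exact: (measurableT_comp measurable_snd measurable_fst).
split=> // f mf f0.
have mG : measurable_fun setT (fun xy : T1 * T2 => \int[mu]_t f (xy.1, up (xy.2, t)))%E.
  apply: (measurable_fun_fubini_tonelli_F (m2 := mu)
    (fun xyt : (T1 * T2) * R => f (xyt.1.1, up (xyt.1.2, xyt.2)))) => //.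
  exact: (measurableT_comp mf mup2).
rewrite (fubini_tonelli1 f)// (fubini_tonelli1 _ mG)/=; last first.
  by move=> xy; exact: integral_ge0.
apply: eq_integral => x _; rewrite /fubini_F /=.
rewrite (rup (fun y => f (x, y)))//.
by apply: (measurableT_comp mf); exact: measurable_pair1.
Qed.

Lemma ge0_integral_product_lawS n (mu : 'I_n.+1 -> probability R R)
    (f : n.+1.-tuple R -> \bar R) :
  measurable_fun setT f -> (forall z, (0 <= f z)%E) ->
  (\int[product_law mu]_z f z =
   \int[mu ord0 \x product_law (fun i => mu (lift ord0 i))]_xw
     f (Defs.cons_tuple xw))%E.
Proof. by move=> mf f0; rewrite ge0_integral_distribution. Qed.

Definition upd n (i : 'I_n) (zt : n.-tuple R * R) : n.-tuple R :=
  [tuple if j == i then zt.2 else tnth zt.1 j | j < n].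

Lemma tnth_upd n (i j : 'I_n) z t :
  tnth (upd i (z, t)) j = if j == i then t else tnth z j.
Proof. by rewrite tnth_mktuple. Qed.

Lemma measurable_upd n (i : 'I_n) : measurable_fun setT (upd i).
Proof.
apply/measurable_fun_tnthP => j.
apply: (eq_measurable_fun (fun zt : n.-tuple R * R => if j == i then zt.2 else tnth zt.1 j)).
  by move=> zt _; rewrite /= tnth_mktuple.
case: (j == i); first exact: measurable_snd.
apply: (@measurableT_comp _ _ _ _ _ _ (fun x => tnth x j)) => //=.
exact: measurable_tnth.
Qed.

Lemma upd_cons0 n x (w : n.-tuple R) t :
  upd ord0 (Defs.cons_tuple (x, w), t) = Defs.cons_tuple (t, w).
Proof.
apply: eq_from_tnth => j; rewrite tnth_upd.
by have [k ->|->] := unliftP ord0 j; rewrite ?eqxx// !tnthS.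
Qed.

Lemma upd_consS n (i : 'I_n) x (w : n.-tuple R) t :
  upd (lift ord0 i) (Defs.cons_tuple (x, w), t) = Defs.cons_tuple (x, upd i (w, t)).
Proof.
apply: eq_from_tnth => j; rewrite tnth_upd.
have [k ->|->//] := unliftP ord0 j.
by rewrite !tnthS tnth_upd (inj_eq lift_inj).
Qed.

(** For the first coordinate, integrating it out leaves a function of the
    others, and integrating that constant in it changes nothing; the later
    coordinates follow by induction. *)
Lemma resampled_product_law n (mu : 'I_n -> probability R R) i :
  resampled (product_law mu) (mu i) (upd i).
Proof.
elim: n mu i => [mu []//|n IH mu i]; split; first exact: measurable_upd.
move=> f mf f0; rewrite ge0_integral_product_lawS//.
have mG : measurable_fun setT (fun z => \int[mu i]_t f (upd i (z, t)))%E.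
  apply: (measurable_fun_fubini_tonelli_F (m2 := mu i) (f \o upd i)) => //.
    exact: (measurableT_comp mf (@measurable_upd _ _)).
  by move=> z; exact: f0.
have mfc : measurable_fun setT (f \o @Defs.cons_tuple R n).
  by apply: (measurableT_comp mf); exact: Defs.measurable_cons_tuple.
rewrite ge0_integral_product_lawS//; last by move=> z; exact: integral_ge0.
have [j ->{i mG}|->{i mG}] := unliftP ord0 i.
  have [_ r] := resampled_pairr (mu ord0) (IH (fun i => mu (lift ord0 i)) j).
  rewrite (r (f \o @Defs.cons_tuple R n))//; last by move=> z; exact: f0.
  by apply: eq_integral => -[x w] _; apply: eq_integral => t _; rewrite upd_consS.
rewrite (fubini_tonelli2 (f \o @Defs.cons_tuple R n))//; last by move=> z; exact: f0.
set nu := product_law _; pose G := fubini_G (mu ord0) (f \o @Defs.cons_tuple R n).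
have mG : measurable_fun setT G.
  by apply: (measurable_fun_fubini_tonelli_G (m1 := mu ord0)) => // z; exact: f0.
have G0 w : (0 <= G w)%E by apply: integral_ge0 => t _; exact: f0.
transitivity (\int[mu ord0 \x nu]_xw G xw.2)%E; last first.
  apply: eq_integral => -[x w] _; apply: eq_integral => t _ /=.
  by rewrite upd_cons0.
rewrite (fubini_tonelli2 (G \o snd))//; last 2 first.
- exact: measurableT_comp.
- by move=> z; exact: G0.
apply: eq_integral => w _; rewrite /fubini_G /=.
rewrite (integral_cst (mu ord0) measurableT (G w)).
by rewrite [X in (_ * X)%E]probability_setT mule1.
Qed.

Section consequences.
Context d (T : measurableType d) (pi : probability T R) (mu : probability R R)
  (up : T * R -> T) (rup : resampled pi mu up).

(** Extends the invariance to signed integrable functions through their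
    positive and negative parts. *)
Lemma resampled_integral (f : T -> \bar R) :
  pi.-integrable setT f ->
  (pi \x mu)%E.-integrable setT (f \o up) /\
  (\int[pi]_x f x = \int[pi]_x \int[mu]_t f (up (x, t)))%E.
Proof.
have [mup r] := rup => fi; have mf := measurable_int _ fi.
have rE (g : T -> \bar R) : measurable_fun setT g -> (forall x, (0 <= g x)%E) ->
    (\int[pi]_x g x = \int[pi \x mu]_xt g (up xt))%E.
  move=> mg g0; rewrite (r _ mg g0) (fubini_tonelli1 (g \o up))//.
    exact: measurableT_comp.
  by move=> x; exact: g0.
have fui : (pi \x mu)%E.-integrable setT (f \o up).
  apply/integrableP; split; first exact: measurableT_comp.
  have := rE (abse \o f); rewrite /= => <-//.
  - by have /integrableP[] := fi.
  - exact: measurableT_comp.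
split=> //.
have -> : (\int[pi]_x \int[mu]_t f (up (x, t)) = \int[pi \x mu]_xt (f \o up) xt)%E.
  exact: integral12_prod_meas1.
have mp : measurable_fun setT f^\+%E by exact: measurable_funepos.
have mn : measurable_fun setT f^\-%E by exact: measurable_funeneg.
rewrite [LHS]integralE [RHS]integralE !(funepos_comp f up) !(funeneg_comp f up).
by rewrite (rE _ mp (funepos_ge0 f)) (rE _ mn (funeneg_ge0 f)).
Qed.

End consequences.

Lemma bounded_integrable d (T : measurableType d) (pi : probability T R)
    (f : T -> R) (B : R) :
  measurable_fun setT f -> (forall x, `|f x| <= B) ->
  pi.-integrable setT (EFin \o f).
Proof.
move=> mf fB; apply: measurable_bounded_integrable => //.
  by apply: le_lt_trans (probability_le1 pi measurableT) _; rewrite ltry.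
by exists B; split; [exact: num_real|move=> M /ltW BM x _; exact: le_trans BM].
Qed.

Section normal_coordinate.
Context d (T : measurableType d) (pi : probability T R) (m v : R).
Variables (up : T * R -> T) (X : T -> R).
Hypothesis (v0 : 0 < v) (rup : resampled pi (normal1 m v) up).
Hypothesis (mX : measurable_fun setT X) (Xup : forall xt, X (up xt) = xt.2).

Lemma integral_normal_coord_sqr : (\int[pi]_x ((X x - m) ^+ 2)%:E = v%:E)%E.
Proof.
rewrite (rup.2 (fun x => ((X x - m) ^+ 2)%:E)).
- rewrite -[RHS]mule1 -(probability_setT pi).
  rewrite -(integral_cst pi measurableT v%:E).
  apply: eq_integral => x _.
  under eq_integral do rewrite Xup /=.
  exact: integral_normal1_sqr.
- by apply/measurable_EFinP; apply: measurable_funX; exact: measurable_funB.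
- by move=> x; rewrite lee_fin sqr_ge0.
Qed.

Lemma integrable_normal_coord_sqr :
  pi.-integrable setT (fun x => ((X x - m) ^+ 2)%:E).
Proof.
apply/integrableP; split.
  by apply/measurable_EFinP; apply: measurable_funX; exact: measurable_funB.
under eq_integral do rewrite abse_EFin ger0_norm ?sqr_ge0//.
by rewrite integral_normal_coord_sqr ltry.
Qed.

Lemma integrable_normal_coordM (f : T -> R) (B : R) :
  measurable_fun setT f -> (forall x, `|f x| <= B) ->
  pi.-integrable setT (fun x => ((X x - m) * f x)%:E).
Proof.
move=> mf fB.
apply: (@le_integrable _ _ _ pi setT measurableT _
  (fun x => (B%:E * (1%:E + ((X x - m) ^+ 2)%:E))%E)).
- apply/measurable_EFinP; apply: measurable_funM => //; exact: measurable_funB.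
- move=> x _; rewrite -EFinD -EFinM !abse_EFin lee_fin.
  have B0 : 0 <= B by exact: le_trans (fB x).
  rewrite [leRHS]ger0_norm; last by rewrite mulr_ge0// addr_ge0// sqr_ge0.
  by rewrite normrM mulrC; apply: ler_pM => //; exact: ler_norm_1Dsqr.
- apply: integrableZl => //; apply: integrableD => //; last exact: integrable_normal_coord_sqr.
  exact: finite_measure_integrable_cst.
Qed.

(** Resampling freezes everything but the coordinate X, and Stein's identity
    on the line applies to each frozen section. The bound on f and df makes
    the integrability hypotheses uniform over the sections. *)
Lemma stein_normal_coord (f df : T -> R) (B : R) :
  measurable_fun setT f -> measurable_fun setT df ->
  (forall x, `|f x| <= B) -> (forall x, `|df x| <= B) ->
  (forall x (t : R), is_derive t 1 (fun t => f (up (x, t))) (df (up (x, t)))) ->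
  (forall x, continuous (fun t : R => df (up (x, t)))) ->
  (\int[pi]_x ((X x - m) * f x)%:E = v%:E * \int[pi]_x (df x)%:E)%E.
Proof.
move=> mf mdf fB dfB fdf cdf.
have [_ ->] := resampled_integral rup (integrable_normal_coordM mf fB).
have idf := bounded_integrable pi mdf dfB.
have [idfu Edf] := resampled_integral rup idf.
rewrite Edf -integralZl//; last first.
  exact: (integrable_fubini_F idfu).
apply: eq_integral => x _.
under eq_integral do rewrite Xup /=.
have [q1 q2] : (forall y, `|f (up (x, y))| <= B * (1 + (y - m) ^+ 2)) /\
    (forall y, `|df (up (x, y))| <= B * (1 + (y - m) ^+ 2)).
  have B0 : 0 <= B by exact: le_trans (fB x).
  by split=> y; [apply: (le_trans (fB _))|apply: (le_trans (dfB _))];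
    rewrite ler_peMr// lerDl sqr_ge0.
apply: (@stein_normal1 R m v (fun t => f (up (x, t))) (fun t => df (up (x, t))) B) => //.
move=> t; rewrite normrM mulrC; apply: ler_pM => //; exact: ler_norm_1Dsqr.
Qed.

End normal_coordinate.
End resampling.

(** * Risk as an integral over the standard model *)

Section model.
Context {R : realType}.

(** The vector whose squared length is the chi-square variable. *)
Definition std_normal_vec n : probability (n.-tuple R) R :=
  normal_vec [tuple of nseq n 0] 1.

Lemma measurable_loss d disp (T : measurableType disp) (f th : T -> d.-tuple R) v :
  measurable_fun setT f -> measurable_fun setT th ->
  measurable_fun setT (fun x => loss (f x) (th x) v).
Proof.
move=> mf mth; apply: measurable_sum => i.
apply: measurable_funM => //; apply: measurable_funX; apply: measurable_funB.
  by apply: (@measurableT_comp _ _ _ _ _ _ (fun x => tnth x i)) => //; exact: measurable_tnth.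
by apply: (@measurableT_comp _ _ _ _ _ _ (fun x => tnth x i)) => //; exact: measurable_tnth.
Qed.

Lemma loss_ge0 d (a th : d.-tuple R) v : 0 <= v -> 0 <= loss a th v.
Proof. by move=> v0; apply: sumr_ge0 => i _; rewrite divr_ge0// sqr_ge0. Qed.

Section risk_integral.
Context (d n : nat) (disp : measure_display) (Omega : measurableType disp).
Variables (P : d.-tuple R -> R -> probability Omega R).
Variables (Z : {mfun Omega >-> d.-tuple R}) (S : {mfun Omega >-> R}).
Hypothesis hmodel : normal_chi2_model n P Z S.

(** The risk depends on the joint law only, which the model prescribes to be a
    product; realising S as v |w|^2 gives normal coordinates in which Stein's
    identity can be used. *)
Lemma risk_integral (delta : d.-tuple R -> R -> d.-tuple R) theta v : 0 < v ->
  estimator delta ->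
  risk P Z S delta theta v =
  (\int[normal_vec theta v \x std_normal_vec n]_zw
     (loss (delta zw.1 (v * sum_sqr zw.2)%R) theta v)%:E)%E.
Proof.
move=> v0 mdelta; have [ZE SE indep] := hmodel theta v0.
have mss : measurable_fun setT (fun w : n.-tuple R => v * sum_sqr w).
  by apply: measurable_funM => //; exact: measurable_sum_sqr.
pose h2 : {mfun n.-tuple R >-> R} := HB.pack (fun w : n.-tuple R => v * sum_sqr w)
  (isMeasurableFun.Build _ _ _ _ _ mss).
pose m2 : probability R R := distribution (std_normal_vec n) h2.
pose G (zs : d.-tuple R * R) : \bar R := (loss (delta zs.1 zs.2) theta v)%:E.
have mG : measurable_fun setT G by apply/measurable_EFinP; exact: measurable_loss.
have G0 zs : (0 <= G zs)%E by rewrite lee_fin loss_ge0// ltW.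
have mZS : measurable_fun setT (fun w => (Z w, S w)).
  by apply: measurable_fun_pair.
pose ZS : {mfun Omega >-> (d.-tuple R * R)%type} := HB.pack (fun w => (Z w, S w))
  (isMeasurableFun.Build _ _ _ _ _ mZS).
transitivity (\int[normal_vec theta v \x m2]_zs G zs)%E.
  rewrite /risk unlock.
  transitivity (\int[distribution (P theta v) ZS]_zs G zs)%E.
    by rewrite ge0_integral_distribution.
  apply: eq_measure_integral => A mA _; apply/esym.
  apply: product_measure_unique => // B C mB mC.
  have := indep _ _ mB mC; have := ZE _ mB; have := SE _ mC.
  rewrite /distribution /pushforward /= => SE' ZE' PE.
  apply: (etrans PE); rewrite ZE' SE'; congr (_ * _)%E.
rewrite (fubini_tonelli1 G)// (fubini_tonelli1 (fun zw : d.-tuple R * n.-tuple R =>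
  (loss (delta zw.1 (v * sum_sqr zw.2)%R) theta v)%:E))//.
- apply: eq_integral => z _; rewrite /fubini_F /=.
  rewrite ge0_integral_distribution//.
  by apply: (measurableT_comp mG); exact: measurable_pair1.
- have mh : measurable_fun setT (fun zw : d.-tuple R * n.-tuple R => (zw.1, v * sum_sqr zw.2)).
    by apply: measurable_fun_pair => //; apply: (measurableT_comp mss).
  exact: (measurableT_comp mG mh).
- by move=> zw; exact: (G0 (_, _)).
Qed.

End risk_integral.

Definition tuple_add n (a x : n.-tuple R) : n.-tuple R :=
  [tuple tnth a i + tnth x i | i < n].

Lemma measurable_tuple_add n : measurable_fun setT (fun ax => @tuple_add n ax.1 ax.2).
Proof.
apply/measurable_fun_tnthP => i.
apply: (eq_measurable_fun (fun ax : n.-tuple R * n.-tuple R => tnth ax.1 i + tnth ax.2 i)).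
  by move=> ax _; rewrite /= tnth_mktuple.
apply: measurable_funD.
  by apply: (@measurableT_comp _ _ _ _ _ _ (fun x => tnth x i)) => //; exact: measurable_tnth.
by apply: (@measurableT_comp _ _ _ _ _ _ (fun x => tnth x i)) => //; exact: measurable_tnth.
Qed.

Lemma measurable_shift n (a : 'I_n -> R) :
  measurable_fun setT (fun x : n.-tuple R => [tuple a i + tnth x i | i < n]).
Proof.
apply/measurable_fun_tnthP => i.
apply: (eq_measurable_fun (fun x : n.-tuple R => a i + tnth x i)).
  by move=> x _; rewrite /= tnth_mktuple.
by apply: measurable_funD => //; exact: measurable_tnth.
Qed.

(** A location family: the mean can be moved from the law into the argument.
    This writes the data as theta plus noise, with theta and the noise
    independent under the prior. *)
Lemma ge0_integral_normal_vec_translate n (a m : n.-tuple R) v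
    (f : n.-tuple R -> \bar R) : 0 < v ->
  measurable_fun setT f -> (forall x, (0 <= f x)%E) ->
  (\int[normal_vec (tuple_add a m) v]_z f z = \int[normal_vec m v]_x f (tuple_add a x))%E.
Proof.
move=> v0; rewrite /normal_vec.
have -> : (fun i => normal1 (tnth (tuple_add a m) i) v) =
    (fun i => normal1 (tnth a i + tnth m i) v).
  by apply/funext => i; rewrite tnth_mktuple.
rewrite /tuple_add; move: {a m} (tnth a) (tnth m) f.
elim: n => [|n IH] a m f mf f0; first rewrite /=.
  have m0 := measurableT_comp mf (measurable_shift a).
  rewrite integral_dirac// (integral_dirac _ _ m0)//.
  by congr (_ * _)%E; rewrite /comp; congr (f _); apply: eq_from_tnth => -[].
have mfc : measurable_fun setT (f \o @Defs.cons_tuple R n).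
  by apply: (measurableT_comp mf); exact: Defs.measurable_cons_tuple.
have mft : measurable_fun setT (fun x : n.+1.-tuple R => f [tuple a i + tnth x i | i < n.+1]).
  exact: (measurableT_comp mf (measurable_shift a)).
have mftc : measurable_fun setT ((fun x : n.+1.-tuple R => f [tuple a i + tnth x i | i < n.+1])
    \o @Defs.cons_tuple R n).
  by apply: (measurableT_comp mft); exact: Defs.measurable_cons_tuple.
apply: (etrans (ge0_integral_product_lawS _ mf f0)); apply/esym.
apply: (etrans (ge0_integral_product_lawS _ mft (fun=> f0 _))); apply/esym.
apply: (etrans (fubini_tonelli1 _ mfc (fun=> f0 _))); apply/esym.
apply: (etrans (fubini_tonelli1 _ mftc (fun=> f0 _))); apply/esym.
rewrite /fubini_F.
set nu := product_law (fun i => normal1 (m (lift ord0 i)) v).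
pose shift (w : n.-tuple R) : n.-tuple R := [tuple a (lift ord0 i) + tnth w i | i < n].
pose G x := (\int[nu]_w f (Defs.cons_tuple (x, shift w)))%E.
transitivity (\int[normal1 (a ord0 + m ord0) v]_x G x)%E.
  apply: eq_integral => x _.
  apply: (IH (fun i => a (lift ord0 i)) (fun i => m (lift ord0 i))
    (fun w => f (Defs.cons_tuple (x, w)))) => //.
  by apply: (measurableT_comp mfc); exact: measurable_pair1.
rewrite ge0_integral_normal1_translate//; last 2 first.
- apply: (measurable_fun_fubini_tonelli_F (m2 := nu) (fun xw => f (Defs.cons_tuple (xw.1, shift xw.2)))) => //.
  have ms : measurable_fun setT (fun xw : R * n.-tuple R => (xw.1, shift xw.2)).
    apply: measurable_fun_pair => //.
    exact: (measurableT_comp (measurable_shift _)).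
  exact: (measurableT_comp mfc ms).
- by move=> x; apply: integral_ge0 => w _; exact: f0.
apply: eq_integral => x _; apply: eq_integral => w _ /=; congr f.
apply: eq_from_tnth => i; rewrite tnth_mktuple.
by have [j ->|->] := unliftP ord0 i; rewrite ?tnthS// tnth_mktuple.
Qed.

(** Resampling only theta_j (by up1) and its noise (by up2) freezes all other
    coordinates and the scale statistic; as the estimate sees these two
    numbers only through their sum, the one-dimensional Bayes bound applies to
    each frozen section. *)
Lemma bayes_coord disp (T : measurableType disp) (pi : probability T R)
    (tau : R) (up1 up2 : T * R -> T) (q : T -> R) : 0 < tau ->
  resampled pi (normal1 0 tau) up1 -> resampled pi (normal1 0 1) up2 ->
  measurable_fun setT q -> (forall x, 0 <= q x) ->
  (forall x, exists2 D : R -> R, measurable_fun setT D &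
     forall t s : R, q (up2 (up1 (x, t), s)) = (D (t + s) - t) ^+ 2) ->
  ((tau / (1 + tau))%:E <= \int[pi]_x (q x)%:E)%E.
Proof.
move=> t0 [mup1 r1] [mup2 r2] mq q0 qD.
have mqe : measurable_fun setT (fun x => (q x)%:E) by exact/measurable_EFinP.
rewrite (r2 _ mqe) => [|x]; last by rewrite lee_fin.
have mG : measurable_fun setT (fun x => \int[normal1 0 1]_s (q (up2 (x, s)))%:E)%E.
  apply: (measurable_fun_fubini_tonelli_F (m2 := normal1 0 1) (fun xs => (q (up2 xs))%:E)).
    exact: (measurableT_comp mqe mup2).
  by move=> xs; rewrite lee_fin.
have G0 x : (0 <= \int[normal1 0 1]_s (q (up2 (x, s)))%:E)%E.
  by apply: integral_ge0 => s _; rewrite lee_fin.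
rewrite (r1 _ mG G0).
have c0 : 0 <= tau / (1 + tau) by rewrite divr_ge0//; lra.
apply: (@le_trans _ _ (\int[pi]_x (tau / (1 + tau))%:E)%E).
  rewrite (integral_cst pi measurableT (tau / (1 + tau))%:E).
  by rewrite [X in (_ * X)%E]probability_setT mule1.
have mGG : measurable_fun setT (fun x => \int[normal1 0 tau]_t
    \int[normal1 0 1]_s (q (up2 (up1 (x, t), s)))%:E)%E.
  apply: (measurable_fun_fubini_tonelli_F (m2 := normal1 0 tau) (fun xt : T * R =>
    \int[normal1 0 1]_s (q (up2 (up1 xt, s)))%:E)%E) => //.
  exact: (measurableT_comp mG mup1).
apply: (ge0_le_integral pi measurableT).
- by move=> x _; rewrite lee_fin.
- exact: measurable_cst.
- exact: mGG.
move=> x _; have [D mD DE] := qD x.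
under [leRHS]eq_integral do under eq_integral do rewrite DE.
exact: bayes_normal1.
Qed.

End model.

(** * Lower bound on the maximal risk *)

Section lower_bound.
Context {R : realType}.

Lemma tuple_add_upd n (j : 'I_n) (a x : n.-tuple R) t s :
  tuple_add (upd j (a, t)) (upd j (x, s)) = upd j (tuple_add a x, t + s).
Proof.
apply: eq_from_tnth => i; rewrite tnth_mktuple !tnth_upd tnth_mktuple.
by case: ifP.
Qed.

Lemma resampled_normal_vec n (m : n.-tuple R) v (i : 'I_n) :
  resampled (normal_vec m v) (normal1 (tnth m i) v) (upd i).
Proof. exact: (resampled_product_law (fun i => normal1 (tnth m i) v)). Qed.

(** A maximum is at least an average over the prior N(0, tau I); letting tau
    grow makes the average approach d. *)
Lemma max_risk_ge (d n : nat) disp (Omega : measurableType disp)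
    (P : d.-tuple R -> R -> probability Omega R)
    (Z : {mfun Omega >-> d.-tuple R}) (S : {mfun Omega >-> R})
    (delta : d.-tuple R -> R -> d.-tuple R) :
  normal_chi2_model n P Z S -> estimator delta ->
  (d%:R%:E <= max_risk P Z S delta)%E.
Proof.
move=> hmodel mdelta; set r := max_risk _ _ _ _.
have bayes (tau : R) : 0 < tau -> ((d%:R * (tau / (1 + tau)))%:E <= r)%E.
  move=> t0; set rho := tau / (1 + tau).
  have rho0 : 0 <= rho by rewrite divr_ge0//; lra.
  pose o : d.-tuple R := [tuple of nseq d 0].
  pose A := normal_vec o tau; pose B := normal_vec o 1.
  pose nv := @std_normal_vec R n.
  pose Bn : probability (d.-tuple R * n.-tuple R)%type R := (B \x nv)%E.
  pose pi : probability (d.-tuple R * (d.-tuple R * n.-tuple R))%type R :=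
    (A \x Bn)%E.
  pose L (p : d.-tuple R * (d.-tuple R * n.-tuple R)) : R :=
    loss (delta (tuple_add p.1 p.2.1) (1 * sum_sqr p.2.2)) p.1 1.
  have mdt : measurable_fun setT (fun p : d.-tuple R * (d.-tuple R * n.-tuple R) =>
      delta (tuple_add p.1 p.2.1) (1 * sum_sqr p.2.2)).
    have mt : measurable_fun setT (fun p : d.-tuple R * (d.-tuple R * n.-tuple R) =>
        (tuple_add p.1 p.2.1, 1 * sum_sqr p.2.2)).
      apply: measurable_fun_pair.
        have m12 : measurable_fun setT (fun p : d.-tuple R * (d.-tuple R * n.-tuple R) =>
          (p.1, p.2.1)).
          by apply: measurable_fun_pair => //; exact: (measurableT_comp measurable_fst measurable_snd).
        exact: (measurableT_comp (@measurable_tuple_add R d) m12).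
      apply: measurable_funM => //.
      apply: (measurableT_comp (@measurable_sum_sqr R n)).
      exact: (measurableT_comp measurable_snd measurable_snd).
    exact: (measurableT_comp mdelta mt).
  have mL : measurable_fun setT (fun p => (L p)%:E).
    by apply/measurable_EFinP; exact: measurable_loss.
  have L0 p : (0 <= (L p)%:E)%E by rewrite lee_fin loss_ge0.
  (* The data are theta plus noise; o is the zero mean of both prior and noise. *)
  have riskE theta : risk P Z S delta theta 1 =
      (\int[Bn]_xw (L (theta, xw))%:E)%E.
    rewrite (risk_integral hmodel _ ltr01 mdelta).
    pose G (zw : d.-tuple R * n.-tuple R) := (loss (delta zw.1 (1 * sum_sqr zw.2)) theta 1)%:E.
    have mG : measurable_fun setT G.
      apply/measurable_EFinP; apply: measurable_loss => //.
      have m1 : measurable_fun setT (fun zw : d.-tuple R * n.-tuple R => (zw.1, 1 * sum_sqr zw.2)).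
        apply: measurable_fun_pair => //; apply: measurable_funM => //.
        exact: (measurableT_comp (@measurable_sum_sqr R n)).
      exact: (measurableT_comp mdelta m1).
    have G0 zw : (0 <= G zw)%E by rewrite lee_fin loss_ge0.
    apply: (etrans (fubini_tonelli2 G mG G0)); apply/esym.
    have mL2 : measurable_fun setT (fun xw => (L (theta, xw))%:E).
      by apply: (measurableT_comp mL); exact: measurable_pair1.
    apply: (etrans (fubini_tonelli2 _ mL2 (fun=> L0 _))); apply/esym.
    apply: eq_integral => w _; rewrite /fubini_G.
    have thE : theta = tuple_add theta o.
      by apply: eq_from_tnth => i; rewrite tnth_mktuple tnth_nseq addr0.
    have mGw : measurable_fun setT (fun z => G (z, w)).
      by apply: (measurableT_comp mG); exact: measurable_pair2.
    rewrite [X in normal_vec X]thE.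
    exact: (ge0_integral_normal_vec_translate theta o ltr01 mGw (fun=> G0 _)).
  apply: (@le_trans _ _ (\int[pi]_p (L p)%:E))%E; last first.
    have -> : (\int[pi]_p (L p)%:E = \int[A]_th \int[Bn]_xw (L (th, xw))%:E)%E.
      exact: (fubini_tonelli1 _ mL L0).
    apply: (@le_trans _ _ (\int[A]_theta r)%E); last first.
      rewrite (integral_cst A measurableT r).
      by rewrite [X in (_ * X)%E]probability_setT mule1.
    have r0 : (0 <= r)%E.
      apply: le_trans (ereal_sup_ubound _); last by exists o, 1; split.
      by rewrite riskE; apply: integral_ge0.
    have mF := measurable_fun_fubini_tonelli_F (m2 := Bn) _ mL L0.
    apply: (ge0_le_integral A measurableT).
    - by move=> x _; exact: integral_ge0.
    - exact: mF.
    - exact: measurable_cst.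
    move=> theta _; apply: ereal_sup_ubound.
    by exists theta, 1; split => //; rewrite riskE.
  pose q (j : 'I_d) (p : d.-tuple R * (d.-tuple R * n.-tuple R)) : R :=
    (tnth (delta (tuple_add p.1 p.2.1) (1 * sum_sqr p.2.2)) j - tnth p.1 j) ^+ 2.
  have mq j : measurable_fun setT (q j).
    apply: measurable_funX; apply: measurable_funB.
      apply: (@measurableT_comp _ _ _ _ _ _ (fun x => tnth x j)) => //; exact: measurable_tnth.
    apply: (@measurableT_comp _ _ _ _ _ _ (fun x => tnth x j)) => //; exact: measurable_tnth.
  have q0 j p : 0 <= q j p by exact: sqr_ge0.
  have LE : (\int[pi]_p (L p)%:E = \sum_(j < d) \int[pi]_p (q j p)%:E)%E.
    rewrite -ge0_integral_sum//.
    - apply: eq_integral => p _; rewrite /L /loss -sumEFin; apply: eq_bigr => j _.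
      by rewrite divr1.
    - by move=> j; apply/measurable_EFinP.
    - by move=> j p _; rewrite lee_fin.
  rewrite LE (_ : (d%:R * rho)%:E = \sum_(j < d) rho%:E)%E; last first.
    by rewrite sumEFin sumr_const card_ord mulr_natl.
  apply: lee_sum => j _.
  have rA : resampled A (normal1 0 tau) (upd j).
    by have := resampled_normal_vec o tau j; rewrite tnth_nseq.
  have rB : resampled B (normal1 0 1) (upd j).
    by have := resampled_normal_vec o 1 j; rewrite tnth_nseq.
  apply: (bayes_coord t0 (resampled_pairl Bn rA)
    (resampled_pairr A (resampled_pairl nv rB)) (mq j) (q0 j)).
  move=> [theta [x w]] /=.
  exists (fun y => tnth (delta (upd j (tuple_add theta x, y)) (1 * sum_sqr w)) j).
    have mu1 : measurable_fun setT (fun y : R => (upd j (tuple_add theta x, y), 1 * sum_sqr w)).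
      apply: measurable_fun_pair => //.
      by apply: (measurableT_comp (@measurable_upd R d j)); exact: measurable_pair1.
    have := measurableT_comp mdelta mu1.
    by apply: (@measurableT_comp _ _ _ _ _ _ (fun x => tnth x j)); exact: measurable_tnth.
  by move=> t s; rewrite /q /= tuple_add_upd tnth_upd eqxx.
apply/lee_addgt0Pr => e e0.
(* d - d tau / (1 + tau) = d / (1 + tau), and this tau brings it below e. *)
have t0 : 0 < (d%:R + 1) / e by rewrite divr_gt0// ltr_wpDl.
apply: (@le_trans _ _ ((d%:R * ((d%:R + 1) / e / (1 + (d%:R + 1) / e)))%:E + e%:E))%E; last first.
  by rewrite leeD2r// bayes.
rewrite -EFinD lee_fin -subr_ge0.
rewrite (_ : _ - _ = e * (e + 1) / (e + (d%:R + 1))).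
  have d0 := ler0n R d; apply: divr_ge0; [apply: mulr_ge0; lra|lra].
have d0 := ler0n R d; field; rewrite !gt_eqF//; lra.
Qed.

End lower_bound.

(** * The pointwise inequality behind the risk bound *)

Section inequalities.
Context {R : realType}.

(** Chebyshev's sum inequality for oppositely ordered sequences, from summing
    the hypothesis over all pairs. *)
Lemma chebyshev_sum n (b g : 'I_n -> R) :
  (forall i j, (b i - b j) * (g i - g j) <= 0) ->
  n%:R * (\sum_i b i * g i) <= (\sum_i b i) * (\sum_i g i).
Proof.
move=> bg.
have h : \sum_i \sum_j (b i - b j) * (g i - g j) <= 0.
  by apply: sumr_le0 => i _; apply: sumr_le0 => j _.
suff E : \sum_i \sum_j (b i - b j) * (g i - g j) =
    2 * (n%:R * (\sum_i b i * g i) - (\sum_i b i) * (\sum_i g i)) by lra.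
have E1 : \sum_i \sum_(j < n) b i * g i = n%:R * (\sum_i b i * g i).
  rewrite mulr_sumr; apply: eq_bigr => i _.
  by rewrite sumr_const card_ord mulr_natl.
have E2 : \sum_(i < n) \sum_j b j * g j = n%:R * (\sum_i b i * g i).
  by rewrite sumr_const card_ord mulr_natl.
have E3 : \sum_i \sum_j b i * g j = (\sum_i b i) * (\sum_i g i).
  by rewrite mulr_suml; apply: eq_bigr => i _; rewrite mulr_sumr.
have E4 : \sum_i \sum_j b j * g i = (\sum_i b i) * (\sum_i g i).
  by rewrite exchange_big.
transitivity (\sum_(i < n) (\sum_(j < n) b i * g i + \sum_(j < n) b j * g j
    - (\sum_(j < n) b i * g j + \sum_(j < n) b j * g i))).
  apply: eq_bigr => i _; rewrite -!big_split/= -sumrB.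
  by apply: eq_bigr => j _; ring.
by rewrite sumrB !big_split/= E1 E2 E3 E4; ring.
Qed.

(** Weighted AM-GM between 1 and expR y, that is convexity of the exponential
    between 0 and y. *)
Lemma expR_bernoulli (r y : R) : 0 <= r -> r <= 1 ->
  expR (r * y) <= 1 - r + r * expR y.
Proof.
move=> r0 r1.
have h1 := expR_ge1Dx (- (r * y)); have h2 := expR_ge1Dx ((1 - r) * y).
have e0 := expR_gt0 (r * y).
have E1 : expR (- (r * y)) * expR (r * y) = 1 by rewrite -expRD addNr expR0.
have E2 : expR ((1 - r) * y) * expR (r * y) = expR y by rewrite -expRD; congr expR; ring.
rewrite -E2 -[X in X - r]E1.
have : 1 <= (1 - r) * expR (- (r * y)) + r * expR ((1 - r) * y).
  have := ler_wpM2l r0 h2; have := ler_wpM2l (_ : 0 <= 1 - r) h1; rewrite subr_ge0 => /(_ r1).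
  lra.
move=> h; have := ler_wpM2r (ltW e0) h; rewrite mul1r => /le_trans; apply.
rewrite mulrDl -!mulrA E1 E2; lra.
Qed.

(** Comparison of l^r and l^1 norms of a probability vector: for r >= 1 each
    power is at most its base, and for r <= 1 concavity makes the uniform
    vector extremal, which costs n^(1 - r). *)
Lemma sum_expR_scale_le n (x : 'I_n -> R) (r : R) :
  0 <= r -> \sum_i expR (x i) = 1 ->
  Num.min 1 (n%:R `^ (r - 1)) * \sum_i expR (r * x i) <= 1.
Proof.
move=> r0 x1.
have q0 : 0 <= \sum_i expR (r * x i) by apply: sumr_ge0 => i _; exact: expR_ge0.
have n0 : (0 < n)%N.
  by case: n x x1 {q0} => // x; rewrite big_ord0 => /esym/eqP; rewrite oner_eq0.
have nR0 : 0 < n%:R :> R by rewrite ltr0n.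
(* The two cases are those of the minimum. *)
have [r1|/ltW r1] := leP 1 r.
  apply: (@le_trans _ _ (1 * \sum_i expR (r * x i))).
    by rewrite ler_wpM2r// ge_min lexx.
  rewrite mul1r -x1; apply: ler_sum => i _; rewrite ler_expR.
  have xi0 : x i <= 0.
    rewrite -ler_expR expR0 -x1 (bigD1 i)//= lerDl.
    by apply: sumr_ge0 => j _; exact: expR_ge0.
  by nra.
apply: (@le_trans _ _ (n%:R `^ (r - 1) * \sum_i expR (r * x i))).
  by rewrite ler_wpM2r// ge_min lexx orbT.
have nE : n%:R `^ (r - 1) = expR (r * ln n%:R) / n%:R.
  by rewrite /powR gt_eqF// mulrBl mul1r expRD expRN lnK.
rewrite nE mulrAC ler_pdivrMr// mul1r mulr_sumr.
(* Tangent of the power r at the uniform weights expR (x i) = 1 / n. *)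
apply: (@le_trans _ _ (\sum_(i < n) (1 - r + r * (n%:R * expR (x i))))).
  apply: ler_sum => i _; rewrite -expRD -mulrDr -[X in r * (X * _)]lnK ?posrE//.
  by rewrite -expRD; exact: expR_bernoulli.
rewrite big_split/= sumr_const card_ord -mulr_sumr -mulr_sumr x1.
by rewrite -mulr_natl; lra.
Qed.

(** The arithmetic core. Here f and P stand for the profile and its derivative
    in the logarithm of its argument, b for the mean of the weights, and X, Y,
    W for the sums to which Chebyshev's inequality is applied. The only sign
    that is not given is that of P: for P >= 0 the terms in P help, and for P
    < 0 they are largest when X and k Y equal b, where the hypothesis on P is
    exactly what is needed. *)
Lemma drift_le0 (N c k f P X Y W b t s : R) :
  0 < N -> 0 < c -> 0 < k -> 0 <= f -> f <= 2 * c * k ->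
  0 <= P * (2 * c * k + 2 * c / N * f) + c * f * (2 * c * k - f) ->
  0 <= X -> X <= b -> 0 <= Y -> k * Y <= b -> c * b <= W ->
  0 <= t -> t <= 1 -> 0 <= s -> s <= 1 ->
  - 2 * (P * X + f * W) + t * (f ^+ 2 - 2 / N * f * P * s) * Y <= 0.
Proof.
move=> N0 c0 k0 f0 fM hP X0 Xb Y0 kY cW t0 t1 s0 s1.
have b0 : 0 <= b by exact: le_trans Xb.
(* After multiplication by k only k Y occurs, which is comparable to b. *)
rewrite -(pmulr_rle0 _ k0).
have fW : f * (c * b) <= f * W by exact: ler_wpM2l.
have f2 : 0 <= f ^+ 2 by exact: sqr_ge0.
have tY : t * (k * Y) <= b.
  by apply: le_trans kY; rewrite ler_piMl// mulr_ge0// ltW.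
have tY0 : 0 <= t * (k * Y) by rewrite !mulr_ge0// ltW.
have f2Y : f ^+ 2 * (t * (k * Y)) <= f ^+ 2 * b by exact: ler_wpM2l.
have kfW : k * (f * (c * b)) <= k * (f * W) by rewrite ler_pM2l.
have N2 : 0 < 2 / N by rewrite divr_gt0.
rewrite (_ : k * _ = - 2 * (k * P * X) - 2 * (k * (f * W)) + f ^+ 2 * (t * (k * Y))
   - P * (2 / N * f * (s * (t * (k * Y))))); last by ring.
have sY : s * (t * (k * Y)) <= b by apply: le_trans tY; rewrite ler_piMl.
have sY0 : 0 <= s * (t * (k * Y)) by rewrite mulr_ge0.
have fN : 0 <= 2 / N * f by rewrite mulr_ge0// ltW.
have gY : 2 / N * f * (s * (t * (k * Y))) <= 2 / N * f * b by exact: ler_wpM2l.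
have gY0 : 0 <= 2 / N * f * (s * (t * (k * Y))) by rewrite mulr_ge0.
have fMb : 0 <= f * b * (2 * c * k - f) by rewrite !mulr_ge0// subr_ge0.
have [P0|/ltW P0] := leP 0 P.
  have h1 : 0 <= k * P * X by rewrite !mulr_ge0// ltW.
  have h2 : 0 <= P * (2 / N * f * (s * (t * (k * Y)))) by exact: mulr_ge0.
  rewrite expr2 in f2Y *; lra.
have P0' : 0 <= - P by rewrite oppr_ge0.
have h1 : k * - P * X <= k * - P * b by rewrite ler_wpM2l// mulr_ge0// ltW.
have h2 : - P * (2 / N * f * (s * (t * (k * Y)))) <= - P * (2 / N * f * b) by exact: ler_wpM2l.
have hP' : 0 <= P * (2 * k + 2 / N * f) + f * (2 * c * k - f).
  by rewrite -(pmulr_rge0 _ c0); apply: le_trans hP _; rewrite le_eqVlt; apply/orP; left; apply/eqP; ring.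
have := mulr_ge0 b0 hP'.
rewrite expr2 in f2Y *; lra.
Qed.

(** The weights are kept in logarithmic form, x i being p times the logarithm
    of a coordinate relative to the norm; rho is the ratio t^2 / (t^2 + e),
    equal to 1 before regularisation, and t and s collect the damping of the
    scale. *)
Lemma shrinkage_drift_le0 (d : nat) (x rho : 'I_d -> R) (p a N f P t s : R) :
  let c := d%:R - 2 - a * (d%:R - 1) in
  let k := Num.min 1 (d%:R `^ ((2 - a) / p - 1)) in
  let b i := expR (- (a / p) * x i) in
  0 < p -> 0 <= a -> a <= 1 -> 0 < N -> 0 < c ->
  \sum_i expR (x i) = 1 -> (forall i, 0 <= rho i <= 1) ->
  0 <= f -> f <= 2 * c * k ->
  0 <= P * (2 * c * k + 2 * c / N * f) + c * f * (2 * c * k - f) ->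
  0 <= t -> t <= 1 -> 0 <= s -> s <= 1 ->
  - 2 * (P * (\sum_i b i * expR (x i) * rho i) +
         f * (\sum_i b i * (1 - a * rho i - (2 - a) * expR (x i) * rho i))) +
  t * (f ^+ 2 - 2 / N * f * P * s) *
    (\sum_i b i * expR ((2 - a) / p * x i) * rho i) <= 0.
Proof.
move=> c k b p0 a0 a1 N0 c0 x1 rho01 f0 fM hP t0 t1 s0 s1.
have d0 : (0 < d)%N.
  rewrite lt0n; apply/eqP => d0; move: x1; rewrite big1 => [/esym/eqP|i _].
    by rewrite oner_eq0.
  by have := ltn_ord i; rewrite [X in (_ < X)%N]d0.
have dR0 : 0 < d%:R :> R by rewrite ltr0n.
have b0 i : 0 < b i by exact: expR_gt0.
have k0 : 0 < k by rewrite lt_min ltr01 powR_gt0.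
have rle (w : 'I_d -> R) : (forall i, 0 <= w i) ->
    \sum_i b i * w i * rho i <= \sum_i b i * w i.
  move=> w0; apply: ler_sum => i _; have /andP[? ?] := rho01 i.
  by rewrite ler_piMr// mulr_ge0// ltW.
have cheb (r : R) : 0 <= r -> d%:R * (\sum_i b i * expR (r * x i)) <=
    (\sum_i b i) * (\sum_i expR (r * x i)).
  move=> r0; apply: chebyshev_sum => i j.
  have ap0 : 0 <= a / p by rewrite divr_ge0// ltW.
  have [xij|/ltW xij] := leP (x i) (x j).
    apply: mulr_ge0_le0.
      by rewrite subr_ge0 ler_expR !mulNr lerN2 ler_wpM2l.
    by rewrite subr_le0 ler_expR ler_wpM2l.
  apply: mulr_le0_ge0.
    by rewrite subr_le0 ler_expR !mulNr lerN2 ler_wpM2l.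
  by rewrite subr_ge0 ler_expR ler_wpM2l.
have Xb : \sum_i b i * expR (x i) * rho i <= (\sum_i b i) / d%:R.
  apply: (le_trans (rle _ (fun i => expR_ge0 _))).
  rewrite ler_pdivlMr// mulrC.
  have := cheb 1 ler01; under eq_bigr do rewrite mul1r.
  by under [X in _ <= _ * X]eq_bigr do rewrite mul1r; rewrite x1 mulr1.
apply: (drift_le0 (b := (\sum_i b i) / d%:R) N0 c0 k0 f0 fM hP) => //.
- apply: sumr_ge0 => i _; have /andP[? ?] := rho01 i.
  by rewrite !mulr_ge0// ?expR_ge0// ltW.
- apply: sumr_ge0 => i _; have /andP[? ?] := rho01 i.
  by rewrite !mulr_ge0// ?expR_ge0// ltW.
- have r0 : 0 <= (2 - a) / p by rewrite divr_ge0 ?ltW//; lra.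
  apply: (le_trans (ler_wpM2l (ltW k0) (rle _ (fun i => expR_ge0 _)))).
  rewrite ler_pdivlMr// -mulrA [X in k * X]mulrC.
  apply: (le_trans (ler_wpM2l (ltW k0) (cheb _ r0))).
  rewrite mulrCA ler_piMr//; first by apply: sumr_ge0 => i _; exact: ltW.
  exact: sum_expR_scale_le.
- apply: (@le_trans _ _ ((1 - a) * (\sum_i b i) - (2 - a) * (\sum_i b i * expR (x i) * rho i))).
    have a2 : 0 <= 2 - a by lra.
    have := ler_wpM2l a2 Xb; set B := \sum_i b i.
    have -> : c * (B / d%:R) = (1 - a) * B - (2 - a) * (B / d%:R).
      by rewrite /c; field; rewrite gt_eqF.
    lra.
  rewrite !mulr_sumr -sumrB; apply: ler_sum => i _.
  have /andP[r0 r1] := rho01 i.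
  have : a * (b i * rho i) <= a * b i.
    by rewrite ler_wpM2l// ler_piMr// ltW.
  by rewrite !mulrBr; lra.
Qed.

End inequalities.

(** * Smoothing the shrinkage profile *)

Section smoothing.
Context {R : realType}.
Local Notation mu := (@lebesgue_measure R).

Lemma ln_ge1BV (r : R) : 0 < r -> 1 - r^-1 <= ln r.
Proof.
move=> r0; have := expR_ge1Dx (- ln r).
rewrite expRN lnK ?posrE//; lra.
Qed.

(** Integrated form of the differential inequality f' >= - H(f), with an error
    of second order in the step. It follows from ln r >= 1 - 1/r applied to
    the two logarithmic increments, so no derivative of the profile is
    involved. *)
Lemma log_drop (c be M x y dl : R) :
  0 < c -> 0 <= be -> 0 < y -> y < x -> x < M -> 0 <= dl ->
  ln x - (1 + be) * ln (M - x) <= c * dl + (ln y - (1 + be) * ln (M - y)) ->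
  x - y <= dl * (c * x * (M - x) / (M + be * x)) + c ^+ 2 * M / 4 * dl ^+ 2.
Proof.
move=> c0 be0 y0 yx xM dl0 hl.
have x0 : 0 < x := lt_trans y0 yx.
have M0 : 0 < M := lt_trans x0 xM.
have Mx : 0 < M - x by rewrite subr_gt0.
have My : 0 < M - y by rewrite subr_gt0 (lt_trans yx).
have D0 : 0 < M + be * x by rewrite ltr_pwDl// mulr_ge0// ltW.
have be1 : 0 <= 1 + be := addr_ge0 ler01 be0.
have key : 1 - y / x + (1 + be) * (1 - (M - x) / (M - y)) <= c * dl.
  have := ln_ge1BV (divr_gt0 x0 y0); rewrite ln_div ?posrE// invf_div => r1.
  have := ler_wpM2l be1 (ln_ge1BV (divr_gt0 My Mx)).
  rewrite ln_div ?posrE// invf_div => r2.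
  by clear -hl r1 r2; lra.
have key2 : (x - y) * (M - y + (1 + be) * x) <= c * dl * (x * (M - y)).
  have := ler_wpM2r (mulr_ge0 (ltW x0) (ltW My)) key.
  rewrite (_ : (1 - y / x + (1 + be) * (1 - (M - x) / (M - y))) * (x * (M - y)) =
    (x - y) * (M - y + (1 + be) * x))//.
  by field; rewrite !gt_eqF.
(* The quadratic remainder (x - y) (c dl x - (x - y)) is at most its maximum
   (c dl x)^2 / 4, whence the constant c^2 M / 4. *)
have key3 : (x - y) * (M + be * x) <= dl * (c * x * (M - x)) + (c * dl * M) ^+ 2 / 4.
  have q1 : 0 <= (c * dl * x - 2 * (x - y)) ^+ 2 by exact: sqr_ge0.
  have q2 : (c * dl * x) ^+ 2 <= (c * dl * M) ^+ 2.
    rewrite [leLHS]exprMn [leRHS]exprMn; apply: ler_wpM2l; first exact: sqr_ge0.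
    by rewrite ler_sqr ?nnegrE ?ltW.
  by clear -q1 q2 key2; rewrite sqrrB !expr2 in q1 q2 *; lra.
have -> : dl * (c * x * (M - x) / (M + be * x)) =
  (dl * (c * x * (M - x))) / (M + be * x) by rewrite mulrA.
rewrite -lerBlDr ler_pdivlMr//.
have : (c ^+ 2 * M / 4 * dl ^+ 2) * M <= (c ^+ 2 * M / 4 * dl ^+ 2) * (M + be * x).
  apply: ler_wpM2l; last by rewrite lerDl mulr_ge0// ltW.
  by apply: mulr_ge0 (sqr_ge0 _); apply: divr_ge0 => //; apply: mulr_ge0 (sqr_ge0 _) (ltW _).
by clear -key3; rewrite !exprMn in key3; rewrite !expr2 in key3 *; lra.
Qed.

(** Reads the monotonicity of g_phi between e^t and e^(t + dl). When the
    profile increases there is nothing to show; when it strictly decreases,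
    saturation and the zero of g_phi are excluded and log_drop applies. *)
Lemma log_derivative_drop (c be M x y t dl : R) :
  0 < c -> 0 <= be -> 0 < M -> 0 <= x -> x <= M -> 0 <= y -> y <= M -> 0 <= dl ->
  (x < M -> y < M ->
     expR t `^ c * x / (M - x) `^ (1 + be) <=
     expR (t + dl) `^ c * y / (M - y) `^ (1 + be)) ->
  (x = M -> y = M) ->
  x - y <= dl * (c * x * (M - x) / (M + be * x)) + c ^+ 2 * M / 4 * dl ^+ 2.
Proof.
move=> c0 be0 M0 x0 xM y0 yM dl0 hg hM.
have [xy|yx] := leP x y.
  rewrite (@le_trans _ _ 0) ?subr_le0//; apply: addr_ge0.
    apply: mulr_ge0 => //; apply: divr_ge0.
      by rewrite !mulr_ge0 ?subr_ge0// ltW.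
    by rewrite addr_ge0 ?mulr_ge0// ltW.
  apply: mulr_ge0 (sqr_ge0 _); apply: divr_ge0 => //.
  exact: mulr_ge0 (sqr_ge0 _) (ltW _).
have {}xM : x < M.
  by rewrite lt_neqAle xM andbT; apply: contraTneq yx => /hM ->; rewrite -leNgt.
have {}yM : y < M := lt_trans yx xM.
have {}hg := hg xM yM.
have pE s : 0 < expR s `^ c by rewrite powR_gt0 ?expR_gt0.
have gp s z : 0 < z -> z < M -> 0 < expR s `^ c * z / (M - z) `^ (1 + be).
  by move=> z0 zM; apply: divr_gt0; [exact: mulr_gt0|rewrite powR_gt0// subr_gt0].
have {}x0 : 0 < x := le_lt_trans y0 yx.
have {}y0 : 0 < y.
  rewrite lt_neqAle y0 andbT eq_sym; apply: contraTneq hg => ->.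
  by rewrite mulr0 mul0r -ltNge gp.
apply: log_drop => //.
have lnE (s z : R) : 0 < z -> z < M ->
    ln (expR s `^ c * z / (M - z) `^ (1 + be)) = c * s + ln z - (1 + be) * ln (M - z).
  move=> z0 zM; have Mz : 0 < M - z by rewrite subr_gt0.
  rewrite ln_div ?posrE ?powR_gt0//; last exact: mulr_gt0.
  by rewrite lnM ?posrE// !ln_powR expRK.
move: hg; rewrite -ler_ln ?posrE ?gp// !lnE//.
by clear; lra.
Qed.

(** The integral from a base point gives a primitive only to the right of it;
    here the base point moves left with x and the constant is fixed by the
    value at 0. *)
Lemma exists_primitive (f : R -> R) : continuous f ->
  exists P : R -> R, forall x : R, is_derive x 1 P (f x).
Proof.
move=> cf.
pose I (a x : R) : R := \int[mu]_(t in `[a, x]) f t.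
have If a b : mu.-integrable `[a, b] (EFin \o f).
  apply: continuous_compact_integrable; first exact: segment_compact.
  exact: continuous_subspaceT.
have IB a b x : a <= b -> b <= x -> I a x = I a b + I b x.
  move=> ab bx.
  have := @Rintegral_itvB R f (BLeft a) (BRight x) b (If a x).
  rewrite !bnd_simp => /(_ ab bx) E.
  rewrite /I -(@Rintegral_itv_obnd_cbnd R b (BRight x) f) -?E; first by ring.
  by apply: (integrableS _ _ _ (If b x)) => //; exact: subset_itv_oc_cc.
pose P x := I (- `|x| - 1) x - I (- `|x| - 1) 0.
exists P => x.
pose a := - `|x| - 2.
have dI : is_derive x 1 (I a) (f x).
  have ax : a < x by have := ler_norm (- x); rewrite normrN /a; lra.
  have [] := @continuous_FTC1_closed R f a x (x + 1) _ (If _ _) ax (cf x).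
    by rewrite ltrDl.
  by move=> d1 d2; split=> //; rewrite -derive1E.
have dG : is_derive x 1 (fun y => I a y - I a 0) (f x - 0) by exact: is_deriveB.
rewrite subr0 in dG; apply: near_eq_is_derive dG.
apply/nbhs_ballP; exists 1 => //= y; rewrite /ball /= distrC => hy; rewrite /P.
have hy2 : `|y| < `|x| + 1.
  by have := ler_normD (y - x) x; rewrite subrK; lra.
have ay : a <= - `|y| - 1 by rewrite /a; lra.
rewrite (IB a (- `|y| - 1) y)//; last by have := ler_norm (- y); rewrite normrN; lra.
rewrite (IB a (- `|y| - 1) 0)//; last by have := normr_ge0 y; lra.
Qed.

(** Concavity of H(x) = c x (M - x) / (M + be x), as a bound by its tangent
    line at m. *)
Lemma drift_tangent (c be M m x : R) :
  0 < c -> 0 <= be -> 0 < M -> 0 <= m -> 0 <= x ->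
  c * x * (M - x) / (M + be * x) <=
  c * m * (M - m) / (M + be * m) +
  c * (M ^+ 2 - 2 * m * M - be * m ^+ 2) / (M + be * m) ^+ 2 * (x - m).
Proof.
move=> c0 be0 M0 m0 x0.
have Dx : 0 < M + be * x by rewrite ltr_pwDl// mulr_ge0.
have Dm : 0 < M + be * m by rewrite ltr_pwDl// mulr_ge0.
rewrite -subr_ge0.
rewrite (_ : _ - _ = c * M ^+ 2 * (1 + be) * (x - m) ^+ 2 /
    ((M + be * m) ^+ 2 * (M + be * x))); last by field; rewrite !gt_eqF.
apply: divr_ge0; last by rewrite mulr_ge0 ?sqr_ge0// ltW.
apply: mulr_ge0 (sqr_ge0 _); apply: mulr_ge0; last by rewrite addr_ge0.
by apply: mulr_ge0 (sqr_ge0 _); exact: ltW.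
Qed.

(** Average psi over windows of length eta. If P is a primitive of psi, the
    average is Psi t = (P (t + eta) - P t) / eta, and the required inequality
    is psi (t + eta) - psi t + eta H(Psi t) >= 0. Bounding H by its tangent at
    the average m = Psi t turns the finite-difference hypothesis into
    monotonicity of an explicit function, and the increment of that function
    over the window is the claim up to errors that vanish with dl. The
    inequality for Psi is exact, which matters because there is no slack in
    the pointwise bound on the risk. *)
Lemma smooth_profile (psi : R -> R) (c be M C eta : R) :
  0 < c -> 0 <= be -> 0 < M -> 0 < eta -> continuous psi ->
  (forall t, 0 <= psi t <= M) ->
  (forall t dl, 0 <= dl -> psi t - psi (t + dl) <=
     dl * (c * psi t * (M - psi t) / (M + be * psi t)) + C * dl ^+ 2) ->
  exists Psi dPsi : R -> R,
  [/\ forall t : R, is_derive t 1 Psi (dPsi t),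
      continuous dPsi,
      forall t, 0 <= Psi t <= M /\ `|dPsi t| <= M / eta,
      forall t, 0 <= dPsi t * (M + be * Psi t) + c * Psi t * (M - Psi t)
    & forall t, exists2 x, t <= x <= t + eta & Psi t = psi x].
Proof.
move=> c0 be0 M0 eta0 cpsi psi01 drop.
have [P dP] := exists_primitive cpsi.
have mvt (a b : R) : a < b -> exists2 x, a < x < b & P b - P a = psi x * (b - a).
  move=> ab; have [|x] := @MVT R P psi a b ab (fun x _ => dP x).
    apply: continuous_subspaceT => x; apply: differentiable_continuous.
    by apply/derivable1_diffP; case: (dP x).
  by rewrite in_itv /= => xab E; exists x.
exists (fun t => (P (t + eta) - P t) / eta), (fun t => (psi (t + eta) - psi t) / eta).
have mean t : exists2 x, t <= x <= t + eta & (P (t + eta) - P t) / eta = psi x.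
  have [|x /andP[tx xt] E] := mvt t (t + eta); first by rewrite ltrDl.
  exists x; first by rewrite !ltW.
  by rewrite E addrAC subrr add0r mulfK// gt_eqF.
have bnd t : 0 <= (P (t + eta) - P t) / eta <= M by have [x _ ->] := mean t.
split=> //.
- move=> t.
  have dS : is_derive t 1 (fun t => P (t + eta)) (psi (t + eta)).
    have := @is_derive1_comp R P (fun t => t + eta) t (psi (t + eta)) 1 (dP _).
    by rewrite mulr1; apply; apply: is_derive_eq; rewrite addr0.
  by have dPt := dP t; apply: is_derive_eq; rewrite /GRing.scale /= mulr0 add0r mulrC.
- move=> t; apply: cvgM; last exact: cvg_cst.
  apply: cvgB; last exact: cpsi.
  apply: (@continuous_comp _ _ _ (fun t => t + eta) psi); last exact: cpsi.
  by apply: cvgD; [exact: cvg_id|exact: cvg_cst].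
- move=> t; split=> //.
  rewrite normrM (gtr0_norm (_ : 0 < eta^-1)) ?invr_gt0// ler_pM2r ?invr_gt0//.
  have /andP[a1 a2] := psi01 (t + eta); have /andP[b1 b2] := psi01 t.
  by rewrite ler_norml; apply/andP; split; lra.
move=> t; set m := (P (t + eta) - P t) / eta.
have /andP[m0 mM] := bnd t; rewrite -/m in m0 mM.
have Dm : 0 < M + be * m by rewrite ltr_pwDl// mulr_ge0.
pose Hm := c * m * (M - m) / (M + be * m).
suff : 0 <= psi (t + eta) - psi t + eta * Hm.
  move=> h; have : 0 <= (psi (t + eta) - psi t + eta * Hm) * (M + be * m) / eta.
    by apply: divr_ge0 (ltW eta0); apply: mulr_ge0 h (ltW Dm).
  rewrite (_ : _ / eta = (psi (t + eta) - psi t) / eta * (M + be * m) + c * m * (M - m))//.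
  by rewrite /Hm; field; rewrite !gt_eqF.
set b := c * (M ^+ 2 - 2 * m * M - be * m ^+ 2) / (M + be * m) ^+ 2.
pose A := Hm - b * m.
have tan x : 0 <= x -> c * x * (M - x) / (M + be * x) <= A + b * x.
  by move=> x0; have := drift_tangent c0 be0 M0 m0 x0; rewrite -/b -/Hm /A; clear; lra.
have Q (dl : R) : 0 < dl -> 0 <= (P (t + eta + dl) - P (t + eta)) / dl - (P (t + dl) - P t) / dl
    + eta * Hm + C * dl * eta.
  move=> dl0.
  (* W' is the difference quotient of psi plus the tangent bound of H plus the
     error C dl, hence nonnegative by the drop hypothesis. *)
  pose W s := (P (s + dl) - P s) / dl + A * s + b * P s + C * dl * s.
  have dW (s : R) : is_derive s 1 W ((psi (s + dl) - psi s) / dl + A + b * psi s + C * dl).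
    have dS : is_derive s 1 (fun s => P (s + dl)) (psi (s + dl)).
      have := @is_derive1_comp R P (fun s => s + dl) s (psi (s + dl)) 1 (dP _).
      by rewrite mulr1; apply; apply: is_derive_eq; rewrite addr0.
    have dPs := dP s; apply: is_derive_eq; rewrite /GRing.scale /=.
    by clear; ring.
  have teta : t < t + eta by rewrite ltrDl.
  have [|x _ E] := @MVT R W _ t (t + eta) teta (fun s _ => dW s).
    apply: continuous_subspaceT => x; apply: differentiable_continuous.
    by apply/derivable1_diffP; case: (dW x).
  have /andP[p0 _] := psi01 x.
  have h : 0 <= (psi (x + dl) - psi x) / dl + A + b * psi x + C * dl.
    have : 0 <= ((psi (x + dl) - psi x) + dl * (A + b * psi x) + C * dl ^+ 2) / dl.
      apply: divr_ge0 (ltW dl0).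
      have := drop x dl (ltW dl0); have := ler_wpM2l (ltW dl0) (tan _ p0).
      by clear; lra.
    rewrite (_ : _ / dl = (psi (x + dl) - psi x) / dl + A + b * psi x + C * dl)//.
    by field; rewrite gt_eqF.
  have : 0 <= W (t + eta) - W t.
    by rewrite E; apply: mulr_ge0 h _; rewrite subr_ge0 ltW.
  rewrite /W.
  have Pm : P (t + eta) = P t + eta * m by rewrite /m; field; rewrite gt_eqF.
  by rewrite /A Pm; clear; lra.
(* Let dl tend to 0: difference quotients of P tend to psi. *)
have cQ s (e : R) : 0 < e -> exists2 r, 0 < r & forall dl, 0 < dl -> dl < r ->
    `|psi s - (P (s + dl) - P s) / dl| < e.
  move=> e0; have /cvgrPdist_lt /(_ e e0) /nbhs_ballP[r /= r0 hr] := cpsi s.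
  exists r => // dl dl0 dlr; have [|x /andP[sx xs] E] := mvt s (s + dl); first by rewrite ltrDl.
  rewrite E addrAC subrr add0r mulfK ?gt_eqF//; apply: hr.
  rewrite /ball /= ltr_norml; move: sx xs dlr; clear; lra.
rewrite -[leRHS]addr0; apply/ler_addgt0Pr => e e0; rewrite addr0.
have e3 : 0 < e / 3 by rewrite divr_gt0.
have [r1 r10 h1] := cQ (t + eta) _ e3; have [r2 r20 h2] := cQ t _ e3.
have Ce : 0 < `|C| * eta + 1 by rewrite ltr_wpDl// mulr_ge0// ltW.
pose r3 := e / 3 / (`|C| * eta + 1).
have r30 : 0 < r3 by rewrite divr_gt0.
pose dl := Num.min (Num.min r1 r2) r3 / 2.
have mr : 0 < Num.min (Num.min r1 r2) r3 by rewrite !lt_min r10 r20.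
have dl0 : 0 < dl by rewrite divr_gt0.
have dlm : dl < Num.min (Num.min r1 r2) r3 by rewrite ltr_pdivrMr// mulr_natr mulr2n ltrDl.
move: (dlm); rewrite !lt_min -andbA => /and3P[d1 d2 d3].
have := Q _ dl0; have := h1 _ dl0 d1; have := h2 _ dl0 d2.
have C3 : C * dl * eta <= e / 3.
  apply: (@le_trans _ _ (dl * (`|C| * eta + 1))); last by rewrite -ler_pdivlMr// ltW.
  rewrite mulrAC mulrC ler_wpM2l ?(ltW dl0)//.
  apply: (@le_trans _ _ (`|C| * eta)); last by rewrite lerDl.
  by rewrite ler_wpM2r ?(ltW eta0)// ler_norm.
rewrite !ltr_norml => /andP[a1 a2] /andP[b1 b2] q.
move: a1 a2 b1 b2 q C3; clear; lra.
Qed.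

End smoothing.

(** * Derivative of the shrinkage term in one coordinate *)

Lemma derive_continuous (R : realType) (f df : R -> R) :
  (forall t : R, is_derive t 1 f (df t)) -> continuous f.
Proof.
move=> fdf x; apply: differentiable_continuous.
by apply/derivable1_diffP; case: (fdf x).
Qed.

Section one_coordinate.
Context {R : realType}.
Variables (p a e : R).
Hypotheses (p0 : 0 < p) (e0 : 0 < e).

(** Logarithm of the regularised absolute value sqrt (t^2 + e). Working with
    logarithms makes all powers of coordinates and norms exponentials of
    linear expressions. *)
Definition log_abs (t : R) : R := ln (t ^+ 2 + e) / 2.

Let sqe0 (t : R) : 0 < t ^+ 2 + e.
Proof. by rewrite ltr_wpDl// sqr_ge0. Qed.

Lemma expR2_log_abs t : expR (2 * log_abs t) = t ^+ 2 + e.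
Proof. by rewrite /log_abs mulrC divfK// lnK// posrE. Qed.

Lemma is_derive_log_abs (t : R) : is_derive t 1 log_abs (t / (t ^+ 2 + e)).
Proof.
have d1 : is_derive t 1 (fun t : R => t ^+ 2 + e) (2 * t).
  by apply: is_derive_eq; rewrite /GRing.scale /=; ring.
have d2 := @is_derive1_comp R (@ln R) (fun t : R => t ^+ 2 + e) t _ _
  (is_derive1_ln (sqe0 t)) d1.
have d3 : is_derive t 1 log_abs ((t ^+ 2 + e)^-1 * (2 * t) / 2).
  rewrite (_ : log_abs = (@ln R \o (fun t : R => t ^+ 2 + e)) * cst 2^-1); last exact/funext.
  by apply: is_derive_eq; rewrite /GRing.scale /=; ring.
by apply: is_derive_eq; field; rewrite gt_eqF.
Qed.

(** Logarithm of the regularised p-norm as a function of one coordinate t,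
    where Q is the contribution of the others. *)
Definition log_norm_coord (Q t : R) : R := ln (Q + expR (p * log_abs t)) / p.

Let Qe0 Q t : 0 <= Q -> 0 < Q + expR (p * log_abs t).
Proof. by move=> Q0; rewrite ltr_wpDl// expR_gt0. Qed.

Lemma expR_log_norm_coord Q t : 0 <= Q -> expR (p * log_norm_coord Q t) = Q + expR (p * log_abs t).
Proof. by move=> Q0; rewrite /log_norm_coord mulrC divfK ?gt_eqF// lnK// posrE Qe0. Qed.

Lemma is_derive_log_norm_coord (Q t : R) : 0 <= Q ->
  is_derive t 1 (log_norm_coord Q) (expR (p * (log_abs t - log_norm_coord Q t)) * (t / (t ^+ 2 + e))).
Proof.
move=> Q0; have d0 := is_derive_log_abs t.
have d1 : is_derive t 1 (fun t : R => Q + expR (p * log_abs t))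
    (expR (p * log_abs t) * (p * (t / (t ^+ 2 + e)))).
  have d2 : is_derive t 1 (fun t : R => p * log_abs t) (p * (t / (t ^+ 2 + e))).
    by apply: is_derive_eq; rewrite /GRing.scale /=; ring.
  have := @is_derive1_comp R expR (fun t : R => p * log_abs t) t _ _ (is_derive_expR _) d2.
  rewrite /comp => d3.
  by apply: is_derive_eq; rewrite add0r mul1r.
have d2 := @is_derive1_comp R (@ln R) _ t _ _ (is_derive1_ln (Qe0 t Q0)) d1.
have d3 : is_derive t 1 (log_norm_coord Q) ((Q + expR (p * log_abs t))^-1 *
    (expR (p * log_abs t) * (p * (t / (t ^+ 2 + e)))) / p).
  rewrite (_ : log_norm_coord Q = (@ln R \o (fun t : R => Q + expR (p * log_abs t))) * cst p^-1); last exact/funext.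
  by apply: is_derive_eq; rewrite /GRing.scale /=; ring.
apply: is_derive_eq; rewrite mulrBr expRD expRN expR_log_norm_coord//.
have h1 := Qe0 t Q0; have h2 := sqe0 t.
by field; rewrite !gt_eqF.
Qed.

Variables (Psi dPsi : R -> R).
Hypotheses (dP : forall t : R, is_derive t 1 Psi (dPsi t)) (cdP : continuous dPsi).

(** The shrinkage term of one coordinate without the variance factor, phi /
    (h^(2 - a) |t|^a) t, where l and L are the logarithms of the scale and of
    the norm. *)
Definition shrink_coord (l L t : R) : R :=
  Psi (L - l) * expR ((a - 2) * L - a * log_abs t) * t.

(** The derivative is in the form that shrinkage_drift_le0 expects: factors
    expR (p (log_abs t - L)) are the weights, t^2 / (t^2 + e) is rho. *)
Definition dshrink_coord (l L t : R) : R :=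
  expR ((a - 2) * L - a * log_abs t) *
  (dPsi (L - l) * (expR (p * (log_abs t - L)) * (t ^+ 2 / (t ^+ 2 + e))) +
   Psi (L - l) * (1 - a * (t ^+ 2 / (t ^+ 2 + e)) -
     (2 - a) * expR (p * (log_abs t - L)) * (t ^+ 2 / (t ^+ 2 + e)))).

Lemma is_derive_shrink_coord (l Q t : R) : 0 <= Q ->
  is_derive t 1 (fun t => shrink_coord l (log_norm_coord Q t) t) (dshrink_coord l (log_norm_coord Q t) t).
Proof.
move=> Q0; have d0 := is_derive_log_abs t; have d1 := is_derive_log_norm_coord t Q0.
set w := expR (p * (log_abs t - log_norm_coord Q t)) in d1.
have d2 : is_derive t 1 (fun t => log_norm_coord Q t - l) (w * (t / (t ^+ 2 + e))).
  by apply: is_derive_eq; rewrite subr0.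
have d3 := @is_derive1_comp R Psi _ t _ _ (dP _) d2.
have d4 : is_derive t 1 (fun t => (a - 2) * log_norm_coord Q t - a * log_abs t)
    ((a - 2) * (w * (t / (t ^+ 2 + e))) - a * (t / (t ^+ 2 + e))).
  by apply: is_derive_eq; rewrite /GRing.scale /=; ring.
have d5 := @is_derive1_comp R expR _ t _ _ (is_derive_expR _) d4.
rewrite /comp in d3 d5.
apply: is_derive_eq; rewrite /GRing.scale /= /dshrink_coord -/w.
have h2 := sqe0 t.
by field; rewrite !gt_eqF.
Qed.

Lemma continuous_dshrink_coord (l Q : R) : 0 <= Q -> continuous (fun t => dshrink_coord l (log_norm_coord Q t) t).
Proof.
move=> Q0.
have cl : continuous (log_norm_coord Q) by apply: derive_continuous => t; exact: is_derive_log_norm_coord.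
have ce : continuous log_abs by apply: derive_continuous => t; exact: is_derive_log_abs.
have cr : continuous (fun t : R => t ^+ 2 / (t ^+ 2 + e)).
  move=> t; apply: cvgM; first exact: exprn_continuous.
  apply: cvgV; first by rewrite gt_eqF.
  by apply: cvgD; [exact: exprn_continuous|exact: cvg_cst].
have cPs : continuous Psi by exact: derive_continuous dP.
move=> t.
have cw : expR (p * (log_abs x - log_norm_coord Q x)) @[x --> t] --> expR (p * (log_abs t - log_norm_coord Q t)).
  apply: (cvg_comp _ expR); last exact: continuous_expR.
  by apply: cvgM; [exact: cvg_cst|apply: cvgB; [exact: ce|exact: cl]].
have cLl : log_norm_coord Q x - l @[x --> t] --> log_norm_coord Q t - l.
  by apply: cvgB; [exact: cl|exact: cvg_cst].
apply: cvgM.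
  apply: (cvg_comp _ expR); last exact: continuous_expR.
  by apply: cvgB; apply: cvgM; [exact: cvg_cst|exact: cl|exact: cvg_cst|exact: ce].
apply: cvgD; apply: cvgM.
- by apply: (cvg_comp _ dPsi); [exact: cLl|exact: cdP].
- by apply: cvgM => //; exact: cr.
- by apply: (cvg_comp _ Psi); [exact: cLl|exact: cPs].
- apply: cvgB; first by apply: cvgB; [exact: cvg_cst|apply: cvgM; [exact: cvg_cst|exact: cr]].
  by apply: cvgM; [apply: cvgM => //; exact: cvg_cst|exact: cr].
Qed.

End one_coordinate.

(** * Uniform bounds, and the direction of the scale *)

Section bounds.
Context {R : realType}.
Variables (p a e M B : R) (Psi dPsi : R -> R).
Hypotheses (p0 : 0 < p) (a0 : 0 <= a) (a1 : a <= 1) (e0 : 0 < e).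
Hypotheses (PM : forall t, 0 <= Psi t <= M) (dPB : forall t, `|dPsi t| <= B).

Let sqe0 (t : R) : 0 < t ^+ 2 + e.
Proof. by rewrite ltr_wpDl// sqr_ge0. Qed.

Let a2 : 0 <= 2 - a.
Proof. by rewrite subr_ge0 (le_trans a1)// ler1n. Qed.

(** A coordinate is at most the norm, so the weight h^(a - 2) |t|^(- a) is at
    most |t|^(- 2); this is where a <= 2 is used. *)
Lemma expR_weight_le (L t : R) : log_abs e t <= L ->
  expR ((a - 2) * L - a * log_abs e t) <= (t ^+ 2 + e)^-1.
Proof.
move=> tL; rewrite -(expR2_log_abs e0) -expRN ler_expR.
have : (2 - a) * log_abs e t <= (2 - a) * L by rewrite ler_wpM2l.
by lra.
Qed.

Lemma ratio_sqr_itv (t : R) : 0 <= t ^+ 2 / (t ^+ 2 + e) <= 1.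
Proof.
have := sqe0 t => h; have := sqr_ge0 t => h2.
by rewrite divr_ge0 ?(ltW h)//= ler_pdivrMr// mul1r lerDl ltW.
Qed.

Lemma expR_weight_sqr_le (L t : R) : log_abs e t <= L ->
  `|expR ((a - 2) * L - a * log_abs e t) * t| <= 1 + e^-1.
Proof.
move=> tL; rewrite normrM ger0_norm ?expR_ge0//.
apply: (@le_trans _ _ ((t ^+ 2 + e)^-1 * (1 + t ^+ 2))).
  by apply: ler_pM; rewrite ?expR_ge0 ?expR_weight_le ?ler_norm_1Dsqr.
rewrite mulrC ler_pdivrMr// mulrDl mul1r mulrDr mulVf ?gt_eqF//.
have := sqr_ge0 t => h2; have : 0 <= e^-1 * t ^+ 2 by rewrite mulr_ge0// invr_ge0 ltW.
by have := ltW e0; lra.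
Qed.

Let M0 : 0 <= M.
Proof. by have /andP[h1 h2] := PM 0; exact: le_trans h2. Qed.

Lemma shrink_coord_bound (l L t : R) : log_abs e t <= L ->
  `|shrink_coord a e Psi l L t| <= M * (1 + e^-1).
Proof.
move=> tL; rewrite /shrink_coord -mulrA normrM; have /andP[h1 h2] := PM (L - l).
by rewrite (ger0_norm h1); apply: ler_pM => //; exact: expR_weight_sqr_le.
Qed.

Lemma dshrink_coord_bound (l L t : R) : log_abs e t <= L ->
  `|dshrink_coord p a e Psi dPsi l L t| <= e^-1 * (B + M).
Proof.
move=> tL; rewrite /dshrink_coord normrM ger0_norm ?expR_ge0//.
apply: ler_pM; rewrite ?expR_ge0//.
  apply: (le_trans (expR_weight_le tL)).
  by rewrite lef_pV2 ?posrE// lerDr sqr_ge0.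
have /andP[r0 r1] := ratio_sqr_itv t; set r := t ^+ 2 / _ in r0 r1 *.
have w0 : 0 <= expR (p * (log_abs e t - L)) by exact: expR_ge0.
have w1 : expR (p * (log_abs e t - L)) <= 1.
  by rewrite -expR0 ler_expR pmulr_rle0// subr_le0.
set w := expR _ in w0 w1 *.
have wr0 : 0 <= w * r by exact: mulr_ge0.
have wr1 : w * r <= 1 by exact: mulr_ile1.
apply: (le_trans (ler_normD _ _)); apply: lerD; rewrite normrM.
  by rewrite -[leRHS]mulr1 (ger0_norm wr0); apply: ler_pM.
have /andP[h1 h2] := PM (L - l); rewrite (ger0_norm h1) -[leRHS]mulr1.
apply: ler_pM => //; rewrite -mulrA.
have ar0 : 0 <= a * r by exact: mulr_ge0.
have ar1 : a * r <= a by rewrite ler_piMr.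
have u0 : 0 <= (2 - a) * (w * r) by rewrite mulr_ge0.
have u1 : (2 - a) * (w * r) <= 2 - a by rewrite ler_piMr.
by rewrite ler_norml; move: ar0 ar1 u0 u1; lra.
Qed.

End bounds.

Section variance_side.
Context {R : realType}.
Variables (e M B N : R) (Psi dPsi : R -> R).
Hypotheses (e0 : 0 < e) (N0 : 0 < N).
Hypotheses (PM : forall t, 0 <= Psi t <= M) (dPB : forall t, `|dPsi t| <= B).
Hypotheses (dP : forall t : R, is_derive t 1 Psi (dPsi t)) (cdP : continuous dPsi).

(** Logarithm of the regularised estimate of the standard deviation, so that L
    - log_scale s is the logarithm of the argument of phi. *)
Definition log_scale (s : R) : R := ln ((s + e) / N) / 2.

Let se0 s : 0 <= s -> 0 < s + e.
Proof. by move=> s0; rewrite ltr_wpDl. Qed.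

Let es0 s : 0 <= s -> 0 < 1 + e * s.
Proof. by move=> s0; rewrite ltr_pwDl// mulr_ge0// ltW. Qed.

Lemma is_derive_log_scale (s : R) : 0 <= s -> is_derive s 1 log_scale ((s + e)^-1 / 2).
Proof.
move=> s0; have se := se0 s0.
have d1 : is_derive s 1 (fun s => (s + e) / N) N^-1.
  by apply: is_derive_eq; rewrite /GRing.scale /=; ring.
have d2 := @is_derive1_comp R (@ln R) _ s _ _ (is_derive1_ln (divr_gt0 se N0)) d1.
have d3 : is_derive s 1 log_scale (((s + e) / N)^-1 / N / 2).
  rewrite (_ : log_scale = (@ln R \o (fun s => (s + e) / N)) * cst 2^-1); last exact/funext.
  by apply: is_derive_eq; rewrite /GRing.scale /=; ring.
by apply: is_derive_eq; field; rewrite !gt_eqF.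
Qed.

(** The quadratic part of the loss is (1 / N^2) (s / v) radial: squaring s /
    (1 + e s) leaves one factor s, which is written as v times the sum of the
    w_j^2, and the rest is collected here. L and q depend on z only. *)
Definition radial (L q s : R) : R :=
  s * (1 + e * s)^-1 ^+ 2 * Psi (L - log_scale s) ^+ 2 * q.

Definition dradial (L q s : R) : R :=
  (1 + e * s)^-1 ^+ 2 * ((1 - 2 * (e * s / (1 + e * s))) * Psi (L - log_scale s) ^+ 2 -
    s / (s + e) * Psi (L - log_scale s) * dPsi (L - log_scale s)) * q.

Lemma is_derive_radial L q (s : R) : 0 <= s -> is_derive s 1 (radial L q) (dradial L q s).
Proof.
move=> s0; have se := se0 s0; have es := es0 s0; have d0 := is_derive_log_scale s0.
have d1 : is_derive s 1 (fun s => L - log_scale s) (- ((s + e)^-1 / 2)).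
  by apply: is_derive_eq; rewrite /GRing.scale /=; ring.
have d2 := @is_derive1_comp R Psi _ s _ _ (dP _) d1.
have d3 : is_derive s 1 (fun s => 1 + e * s) e.
  by apply: is_derive_eq; rewrite /GRing.scale /=; ring.
have d4 := @is_deriveV R (fun s => 1 + e * s) s _ _ (lt0r_neq0 es) d3.
rewrite /comp in d2; rewrite /radial.
apply: is_derive_eq; rewrite /GRing.scale /= /dradial.
by field; rewrite !gt_eqF.
Qed.

Variable v : R.
Hypothesis v0 : 0 < v.

(** The function to which Stein's identity is applied in the coordinate t =
    w_j: summing w_j scale_coord over j restores the factor s / v. *)
Definition scale_coord (L q s t : R) : R := t * radial L q s.
Definition dscale_coord (L q s t : R) : R := radial L q s + 2 * v * t ^+ 2 * dradial L q s.

Let s_ge0 (c t : R) : 0 <= c -> 0 <= v * (c + t ^+ 2).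
Proof. by move=> c0; rewrite mulr_ge0 ?(ltW v0)// addr_ge0// sqr_ge0. Qed.

Lemma is_derive_scale_coord L q c (t : R) : 0 <= c ->
  is_derive t 1 (fun t => scale_coord L q (v * (c + t ^+ 2)) t) (dscale_coord L q (v * (c + t ^+ 2)) t).
Proof.
move=> c0; have d1 : is_derive t 1 (fun t => v * (c + t ^+ 2)) (v * (2 * t)).
  by apply: is_derive_eq; rewrite /GRing.scale /=; ring.
have d2 := @is_derive1_comp R (radial L q) _ t _ _ (is_derive_radial L q (s_ge0 t c0)) d1.
rewrite /comp in d2; rewrite /scale_coord.
by apply: is_derive_eq; rewrite /GRing.scale /= /dscale_coord; ring.
Qed.

Lemma continuous_dscale_coord (L q c : R) : 0 <= c ->
  continuous (fun t : R => dscale_coord L q (v * (c + t ^+ 2)) t).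
Proof.
move=> c0.
have cs : continuous (fun t : R => v * (c + t ^+ 2)).
  by move=> t; apply: cvgM; [exact: cvg_cst|apply: cvgD; [exact: cvg_cst|exact: exprn_continuous]].
have cg : continuous (fun t : R => radial L q (v * (c + t ^+ 2))).
  apply: derive_continuous => t.
  have d1 : is_derive t 1 (fun t => v * (c + t ^+ 2)) (v * (2 * t)).
    by apply: is_derive_eq; rewrite /GRing.scale /=; ring.
  exact: (@is_derive1_comp R (radial L q) _ t _ _ (is_derive_radial L q (s_ge0 t c0)) d1).
have cLl : continuous (fun t : R => L - log_scale (v * (c + t ^+ 2))).
  apply: derive_continuous => t.
  have d1 : is_derive t 1 (fun t => v * (c + t ^+ 2)) (v * (2 * t)).
    by apply: is_derive_eq; rewrite /GRing.scale /=; ring.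
  have d2 := @is_derive1_comp R log_scale _ t _ _ (is_derive_log_scale (s_ge0 t c0)) d1.
  rewrite /comp in d2.
  exact: is_derive_eq.
have cPs : continuous (fun t : R => Psi (L - log_scale (v * (c + t ^+ 2)))).
  by move=> t; apply: (cvg_comp _ Psi); [exact: cLl|exact: (derive_continuous dP)].
have cdPs : continuous (fun t : R => dPsi (L - log_scale (v * (c + t ^+ 2)))).
  by move=> t; apply: (cvg_comp _ dPsi); [exact: cLl|exact: cdP].
have ces : continuous (fun t : R => (1 + e * (v * (c + t ^+ 2)))^-1).
  move=> t; apply: cvgV; first by rewrite gt_eqF// es0// s_ge0.
  by apply: cvgD; [exact: cvg_cst|apply: cvgM; [exact: cvg_cst|exact: cs]].
have cse : continuous (fun t : R => (v * (c + t ^+ 2) + e)^-1).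
  move=> t; apply: cvgV; first by rewrite gt_eqF// se0// s_ge0.
  by apply: cvgD; [exact: cs|exact: cvg_cst].
move=> t; apply: cvgD; first exact: cg.
apply: cvgM.
  by apply: cvgM; [exact: cvg_cst|exact: exprn_continuous].
apply: cvgM; last exact: cvg_cst.
apply: cvgM.
  by rewrite !expr2; apply: cvgM; exact: ces.
apply: cvgB; apply: cvgM.
- apply: cvgB; first exact: cvg_cst.
  apply: cvgM; first exact: cvg_cst.
  by apply: cvgM; [apply: cvgM; [exact: cvg_cst|exact: cs]|exact: ces].
- by rewrite !expr2; apply: cvgM; exact: cPs.
- by apply: cvgM; [apply: cvgM; [exact: cs|exact: cse]|exact: cPs].
- exact: cdPs.
Qed.

(** Bounds uniform in s, as the damping 1 / (1 + e s) compensates for the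
    growth of s. The extra factor 1 + s / v makes room for the coordinate t in
    scale_coord. *)
Lemma radial_bound L q s : 0 <= s -> 0 <= q ->
  [/\ 0 <= radial L q s, (1 + s / v) * radial L q s <= e^-1 * (1 + (v * e)^-1) * M ^+ 2 * q
    & s * `|dradial L q s| <= e^-1 * (M ^+ 2 + M * B) * q].
Proof.
move=> s0 q0; have es := es0 s0; have se := se0 s0.
have /andP[P0 PMs] := PM (L - log_scale s); have dPs := dPB (L - log_scale s).
set P := Psi _ in P0 PMs *; set D := dPsi _ in dPs *.
have M0 : 0 <= M by exact: le_trans PMs.
have P2 : P ^+ 2 <= M ^+ 2 by rewrite ler_sqr ?nnegrE.
set T := (1 + e * s)^-1.
have T0 : 0 < T by rewrite invr_gt0.
have T1 : T <= 1 by rewrite invf_le1// lerDl mulr_ge0// ltW.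
have sT0 : 0 <= s * T by rewrite mulr_ge0// ltW.
have sT : s * T <= e^-1.
  rewrite ler_pdivrMr// mulrDr mulr1 mulrA mulVf ?gt_eqF// mul1r lerDr invr_ge0 ltW//.
have g0 : 0 <= radial L q s.
  by rewrite /radial; exact: mulr_ge0 (mulr_ge0 (mulr_ge0 s0 (sqr_ge0 _)) (sqr_ge0 _)) q0.
split => //.
- have sv : (1 + s / v) * T <= 1 + (v * e)^-1.
    rewrite ler_pdivrMr// (_ : (1 + _) * (1 + _) = 1 + s / v + (e * s + (v * e)^-1)).
      by rewrite lerDl addr_ge0 ?mulr_ge0 ?invr_ge0 ?mulr_ge0 ?(ltW e0) ?(ltW v0).
    by field; rewrite !gt_eqF.
  rewrite /radial -/P -/T (_ : _ * _ = (s * T) * ((1 + s / v) * T) * P ^+ 2 * q); last by ring.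
  apply: ler_wpM2r => //; apply: ler_pM => //; [|exact: sqr_ge0|].
    by apply: mulr_ge0 => //; apply: mulr_ge0 (ltW T0); rewrite addr_ge0// divr_ge0// ltW.
  apply: ler_pM => //; apply: mulr_ge0; last exact: ltW.
  by rewrite addr_ge0// divr_ge0// ltW.
rewrite /dradial -/P -/T -/D normrM (ger0_norm q0) [leLHS]mulrA; apply: ler_wpM2r => //.
rewrite normrM (ger0_norm (sqr_ge0 T)) [leLHS]mulrA; apply: ler_pM => //.
- by rewrite mulr_ge0// sqr_ge0.
- by rewrite expr2 mulrA; apply: le_trans sT; rewrite ler_piMr.
- set u := e * s / _.
  have u0 : 0 <= u by rewrite divr_ge0 ?(ltW es)// mulr_ge0// ltW.
  have u1 : u <= 1 by rewrite ler_pdivrMr// mul1r lerDr.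
  set r := s / (s + e).
  have r0 : 0 <= r by rewrite divr_ge0// ltW.
  have r1 : r <= 1 by rewrite ler_pdivrMr// mul1r lerDl ltW.
  apply: (le_trans (ler_normB _ _)); apply: lerD.
    rewrite normrM -[leRHS]mul1r; apply: ler_pM => //.
      by rewrite ler_norml; move: u0 u1; lra.
    by rewrite ger0_norm ?sqr_ge0.
  rewrite normrM (ger0_norm (mulr_ge0 r0 P0)); apply: ler_pM => //.
    by rewrite mulr_ge0.
  by rewrite -[leRHS]mul1r; apply: ler_pM.
Qed.

Lemma scale_coord_bound L q s t : 0 <= q -> v * t ^+ 2 <= s ->
  `|scale_coord L q s t| <= e^-1 * (1 + (v * e)^-1) * M ^+ 2 * q /\
  `|dscale_coord L q s t| <= e^-1 * (1 + (v * e)^-1) * M ^+ 2 * q + 2 * (e^-1 * (M ^+ 2 + M * B) * q).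
Proof.
move=> q0 ts; have t2 : 0 <= v * t ^+ 2 by rewrite mulr_ge0 ?(ltW v0)// sqr_ge0.
have s0 : 0 <= s by exact: le_trans ts.
have [g0 g1 g2] := radial_bound L s0 q0.
have sv0 : 0 <= s / v by rewrite divr_ge0// ltW.
have g3 : radial L q s <= (1 + s / v) * radial L q s by rewrite ler_peMl// lerDl.
split.
  apply: le_trans g1; rewrite /scale_coord normrM (ger0_norm g0) ler_wpM2r//.
  apply: (le_trans (ler_norm_1Dsqr t)); rewrite lerD2l.
  by rewrite ler_pdivlMr// mulrC.
apply: (le_trans (ler_normD _ _)); apply: lerD.
  by rewrite ger0_norm// (le_trans g3).
rewrite normrM [`|2 * v * _|]ger0_norm; last by rewrite -mulrA mulr_ge0.
rewrite [leLHS](_ : _ = 2 * (v * t ^+ 2 * `|dradial L q s|)); last by ring.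
rewrite ler_pM2l//.
by apply: le_trans g2; rewrite ler_wpM2r.
Qed.

End variance_side.

(** * Risk of the regularised estimators *)

(** On nonnegative numbers the inverse is the power with exponent - 1, which
    is measurable even at 0. *)
Lemma ge0_measurable_funV (R : realType) d (T : measurableType d) (f : T -> R) :
  measurable_fun setT f -> (forall x, 0 <= f x) ->
  measurable_fun setT (fun x => (f x)^-1).
Proof.
move=> mf f0; apply: (eq_measurable_fun (fun x => f x `^ (-1))).
  by move=> x _; rewrite powR_inv1.
exact: (measurableT_comp (@measurable_powR R (-1)) mf).
Qed.

Section zero_mean.
Context {R : realType} d (T : measurableType d) (pi : probability T R).
Implicit Types f g : T -> R.

(** Integrability is part of the notion so that such functions can be added
    freely. *)
Definition zero_mean f : Prop :=
  pi.-integrable setT (EFin \o f) /\ (\int[pi]_x (f x)%:E = 0)%E.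

Lemma zero_meanD f g : zero_mean f -> zero_mean g -> zero_mean (fun x => f x + g x).
Proof.
move=> [fi f0] [gi g0]; split.
  have := integrableD measurableT fi gi.
  by apply: eq_integrable => // x _; rewrite /= EFinD.
under eq_integral do rewrite EFinD.
by rewrite integralD// f0 g0 adde0.
Qed.

Lemma zero_meanZ (k : R) f : zero_mean f -> zero_mean (fun x => k * f x).
Proof.
move=> [fi f0]; split.
  have := integrableZl measurableT k fi.
  by apply: eq_integrable => // x _; rewrite /= EFinM.
under eq_integral do rewrite EFinM.
by rewrite integralZl// f0 mule0.
Qed.

Lemma zero_mean_sum n (f : 'I_n -> T -> R) :
  (forall i, zero_mean (f i)) -> zero_mean (fun x => \sum_(i < n) f i x).
Proof.
elim: n f => [|n IH] f f0.
  rewrite (_ : (fun x => _) = cst 0); last by apply/funext => x; rewrite big_ord0.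
  by split; [exact: integrable0|exact: integral0].
rewrite (_ : (fun x => _) = (fun x => f ord0 x + \sum_(i < n) f (lift ord0 i) x)).
  by apply: zero_meanD => //; apply: IH => i.
by apply/funext => x; rewrite big_ord_recl.
Qed.

Lemma zero_mean_sub f g (k : R) : pi.-integrable setT (EFin \o f) ->
  pi.-integrable setT (EFin \o g) ->
  (\int[pi]_x (f x)%:E = k%:E * \int[pi]_x (g x)%:E)%E ->
  zero_mean (fun x => f x - k * g x).
Proof.
move=> fi gi fg; have kgi := integrableZl measurableT k gi; split.
  have := integrableB measurableT fi kgi.
  by apply: eq_integrable => // x _; rewrite /= EFinB EFinM.
under eq_integral do rewrite EFinB EFinM.
rewrite integralB// integralZl// fg subee// fin_numM//.
exact: integrable_fin_num.
Qed.

End zero_mean.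

Section regularised_estimator.
Context {R : realType}.
Variables (d n : nat) (p a e v M B : R) (Psi dPsi : R -> R) (theta : d.-tuple R).
Hypotheses (p0 : 0 < p) (a0 : 0 <= a) (a1 : a <= 1) (e0 : 0 < e) (v0 : 0 < v).
Hypotheses (PM : forall t, 0 <= Psi t <= M) (dPB : forall t, `|dPsi t| <= B).
Hypotheses (dP : forall t : R, is_derive t 1 Psi (dPsi t)) (cdP : continuous dPsi).

Let N : R := n%:R + 2.
Let N0 : 0 < N. Proof. by rewrite ltr_wpDl. Qed.

Definition lp_sum (z : d.-tuple R) : R := \sum_i expR (p * log_abs e (tnth z i)).
Definition log_norm (z : d.-tuple R) : R := ln (lp_sum z) / p.
Definition shrink i (z : d.-tuple R) (s : R) : R :=
  shrink_coord a e Psi (log_scale e N s) (log_norm z) (tnth z i).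
Definition dshrink i (z : d.-tuple R) (s : R) : R :=
  dshrink_coord p a e Psi dPsi (log_scale e N s) (log_norm z) (tnth z i).
(** The variance factor s / N, damped so as to be bounded in s. *)
Definition shrink_factor (s : R) : R := s / (1 + e * s) / N.
Definition regularised (z : d.-tuple R) (s : R) : d.-tuple R :=
  [tuple tnth z i - shrink_factor s * shrink i z s | i < d].
(** The squared length of the shrinkage vector without the factor Psi^2; it
    plays the role of q in radial. *)
Definition weight_sum (z : d.-tuple R) : R :=
  \sum_i (expR ((a - 2) * log_norm z - a * log_abs e (tnth z i)) * tnth z i) ^+ 2.

Lemma lp_sum_gt0 (i : 'I_d) z : 0 < lp_sum z.
Proof.
rewrite /lp_sum (bigD1 i)//= ltr_pwDl ?expR_gt0//.
by apply: sumr_ge0 => j _; exact: expR_ge0.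
Qed.

Lemma expR_log_norm (i : 'I_d) z : expR (p * log_norm z) = lp_sum z.
Proof. by rewrite /log_norm mulrC divfK ?gt_eqF// lnK// posrE (lp_sum_gt0 i). Qed.

Lemma log_abs_le_log_norm i z : log_abs e (tnth z i) <= log_norm z.
Proof.
rewrite -(ler_pM2l p0) -ler_expR (expR_log_norm i) /lp_sum (bigD1 i)//= lerDl.
by apply: sumr_ge0 => j _; exact: expR_ge0.
Qed.

(** The index i witnesses that there is a coordinate at all, without which the
    sum is 0. *)
Lemma sum_weights (i : 'I_d) z :
  \sum_j expR (p * (log_abs e (tnth z j) - log_norm z)) = 1.
Proof.
under eq_bigr do rewrite mulrBr expRD expRN (expR_log_norm i).
by rewrite -mulr_suml divff// gt_eqF// (lp_sum_gt0 i).
Qed.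

Lemma log_norm_upd i z t :
  log_norm (upd i (z, t)) = log_norm_coord p e (\sum_(j | j != i) expR (p * log_abs e (tnth z j))) t.
Proof.
rewrite /log_norm /lp_sum (bigD1 i)//= tnth_upd eqxx addrC /log_norm_coord.
congr (ln (_ + _) / _); apply: eq_bigr => j ji.
by rewrite tnth_upd (negbTE ji).
Qed.

Lemma sum_sqr_upd m (j : 'I_m) (w : m.-tuple R) t :
  sum_sqr (upd j (w, t)) = \sum_(k | k != j) tnth w k ^+ 2 + t ^+ 2.
Proof.
rewrite /sum_sqr (bigD1 j)//= tnth_upd eqxx addrC; congr (_ + _).
by apply: eq_bigr => k kj; rewrite tnth_upd (negbTE kj).
Qed.

Lemma sum_sqr_ge0 m (w : m.-tuple R) : 0 <= sum_sqr w.
Proof. by apply: sumr_ge0 => k _; exact: sqr_ge0. Qed.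

Let T := (d.-tuple R * n.-tuple R)%type.
Let S (zw : T) : R := v * sum_sqr zw.2.

Let S0 zw : 0 <= S zw.
Proof. by rewrite mulr_ge0 ?(ltW v0)// sum_sqr_ge0. Qed.

Let es0 s : 0 <= s -> 0 < 1 + e * s.
Proof. by move=> s0; rewrite ltr_pwDl// mulr_ge0// ltW. Qed.

Let mell : measurable_fun setT (log_abs e).
Proof.
apply: measurable_funM => //; apply: (measurableT_comp (@measurable_ln R)).
by apply: measurable_funD => //; exact: measurable_funX.
Qed.

Let mtn m (i : 'I_m) : measurable_fun setT (fun z : m.-tuple R => tnth z i).
Proof. exact: measurable_tnth. Qed.

Let mtz (i : 'I_d) : measurable_fun setT (fun zw : T => tnth zw.1 i).
Proof. exact: (measurableT_comp (mtn i) measurable_fst). Qed.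

Let mtw (j : 'I_n) : measurable_fun setT (fun zw : T => tnth zw.2 j).
Proof. exact: (measurableT_comp (mtn j) measurable_snd). Qed.

Let mlogh : measurable_fun setT log_norm.
Proof.
apply: measurable_funM => //; apply: (measurableT_comp (@measurable_ln R)).
apply: measurable_sum => i; apply: (measurableT_comp (@measurable_expR R)).
by apply: measurable_funM => //; apply: (measurableT_comp mell); exact: mtn.
Qed.

Let mS : measurable_fun setT S.
Proof.
apply: measurable_funM => //.
exact: (measurableT_comp (@measurable_sum_sqr R n) measurable_snd).
Qed.

Let mlam : measurable_fun setT (log_scale e N).
Proof.
apply: measurable_funM => //; apply: (measurableT_comp (@measurable_ln R)).
by apply: measurable_funM => //; exact: measurable_funD.
Qed.

Let mPsi : measurable_fun setT Psi.
Proof. by apply: continuous_measurable_fun; exact: (derive_continuous dP). Qed.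

Let mdPsi : measurable_fun setT dPsi.
Proof. exact: continuous_measurable_fun. Qed.

Let mel i : measurable_fun setT (fun zw : T => log_abs e (tnth zw.1 i)).
Proof. exact: (measurableT_comp mell (mtz i)). Qed.

Let mlo : measurable_fun setT (fun zw : T => log_norm zw.1).
Proof. exact: (measurableT_comp mlogh measurable_fst). Qed.

Let mLl : measurable_fun setT (fun zw : T => log_norm zw.1 - log_scale e N (S zw)).
Proof. by apply: measurable_funB => //; exact: (measurableT_comp mlam mS). Qed.

Let mwt i : measurable_fun setT
  (fun zw : T => expR ((a - 2) * log_norm zw.1 - a * log_abs e (tnth zw.1 i))).
Proof.
apply: (measurableT_comp (@measurable_expR R)).
by apply: measurable_funB; exact: measurable_funM.
Qed.

Let msh i : measurable_fun setT (fun zw : T => shrink i zw.1 (S zw)).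
Proof.
apply: measurable_funM => //; apply: measurable_funM => //.
exact: (measurableT_comp mPsi mLl).
Qed.

Let mrho i : measurable_fun setT
  (fun zw : T => tnth zw.1 i ^+ 2 / (tnth zw.1 i ^+ 2 + e)).
Proof.
apply: measurable_funM; first exact: measurable_funX.
apply: ge0_measurable_funV.
  by apply: measurable_funD => //; exact: measurable_funX.
by move=> x; rewrite addr_ge0 ?sqr_ge0 ?(ltW e0).
Qed.

Let mdsh i : measurable_fun setT (fun zw : T => dshrink i zw.1 (S zw)).
Proof.
have mw : measurable_fun setT (fun zw : T => expR (p * (log_abs e (tnth zw.1 i) - log_norm zw.1))).
  apply: (measurableT_comp (@measurable_expR R)).
  by apply: measurable_funM => //; exact: measurable_funB.
apply: measurable_funM => //; apply: measurable_funD; apply: measurable_funM.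
- exact: (measurableT_comp mdPsi mLl).
- exact: measurable_funM.
- exact: (measurableT_comp mPsi mLl).
- apply: measurable_funB; first by apply: measurable_funB => //; exact: measurable_funM.
  by apply: measurable_funM => //; exact: measurable_funM.
Qed.

Let mT : measurable_fun setT (fun zw : T => (1 + e * S zw)^-1).
Proof.
apply: ge0_measurable_funV.
  by apply: measurable_funD => //; exact: measurable_funM.
by move=> zw; exact: ltW (es0 (S0 zw)).
Qed.

Let mkap : measurable_fun setT (fun zw : T => shrink_factor (S zw)).
Proof. by apply: measurable_funM => //; exact: measurable_funM. Qed.

Let mqz : measurable_fun setT (fun zw : T => weight_sum zw.1).
Proof. by apply: measurable_sum => i; apply: measurable_funX; exact: measurable_funM. Qed.

Let mgv : measurable_fun setT (fun zw : T => radial e N Psi (log_norm zw.1) (weight_sum zw.1) (S zw)).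
Proof.
apply: measurable_funM => //; apply: measurable_funM.
  by apply: measurable_funM => //; exact: measurable_funX.
by apply: measurable_funX; exact: (measurableT_comp mPsi mLl).
Qed.

Let mdgv : measurable_fun setT (fun zw : T => dradial e N Psi dPsi (log_norm zw.1) (weight_sum zw.1) (S zw)).
Proof.
apply: measurable_funM => //; apply: measurable_funM; first exact: measurable_funX.
apply: measurable_funB; apply: measurable_funM.
- apply: measurable_funB => //; apply: measurable_funM => //.
  by apply: measurable_funM => //; exact: measurable_funM.
- by apply: measurable_funX; exact: (measurableT_comp mPsi mLl).
- apply: measurable_funM; last exact: (measurableT_comp mPsi mLl).
  apply: measurable_funM => //; apply: ge0_measurable_funV; first exact: measurable_funD.
  by move=> zw; rewrite addr_ge0// ltW.
- exact: (measurableT_comp mdPsi mLl).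
Qed.

Let pi : probability T R := (normal_vec theta v \x std_normal_vec n)%E.

Let M0 : 0 <= M.
Proof. by have /andP[h1 h2] := PM 0; exact: le_trans h2. Qed.

Let B0 : 0 <= B.
Proof. exact: le_trans (dPB 0). Qed.

Let ie0 : 0 <= e^-1.
Proof. by rewrite invr_ge0 ltW. Qed.

Lemma shrink_factor_bound s : 0 <= s -> `|shrink_factor s| <= e^-1 / N.
Proof.
move=> s0; have es := es0 s0.
rewrite ger0_norm; last by rewrite !divr_ge0// ltW.
rewrite ler_pM2r ?invr_gt0// ler_pdivrMr// mulrDr mulr1 mulrA mulVf ?gt_eqF//.
by rewrite mul1r lerDr.
Qed.

(** Stein's identity in z_i, for the linear term of the loss. *)
Lemma zero_mean_location i : zero_mean pi (fun zw =>
  (tnth zw.1 i - tnth theta i) * (shrink_factor (S zw) * shrink i zw.1 (S zw)) -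
  v * (shrink_factor (S zw) * dshrink i zw.1 (S zw))).
Proof.
have r := resampled_pairl (std_normal_vec n) (resampled_normal_vec theta v i).
set b1 := e^-1 / N * (M * (1 + e^-1)); set b2 := e^-1 / N * (e^-1 * (B + M)).
have eN : 0 <= e^-1 / N by rewrite divr_ge0// ltW.
have b10 : 0 <= b1 := mulr_ge0 eN (mulr_ge0 M0 (addr_ge0 ler01 ie0)).
have b20 : 0 <= b2 := mulr_ge0 eN (mulr_ge0 ie0 (addr_ge0 B0 M0)).
have mf : measurable_fun setT (fun zw : T => shrink_factor (S zw) * shrink i zw.1 (S zw)).
  exact: measurable_funM.
have mdf : measurable_fun setT (fun zw : T => shrink_factor (S zw) * dshrink i zw.1 (S zw)).
  exact: measurable_funM.
have fb (zw : T) : `|shrink_factor (S zw) * shrink i zw.1 (S zw)| <= b1 + b2.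
  apply: (@le_trans _ _ b1); last by rewrite lerDl.
  rewrite normrM; apply: ler_pM => //; first exact: shrink_factor_bound.
  by apply: shrink_coord_bound => //; exact: log_abs_le_log_norm.
have dfb (zw : T) : `|shrink_factor (S zw) * dshrink i zw.1 (S zw)| <= b1 + b2.
  apply: (@le_trans _ _ b2); last by rewrite lerDr.
  rewrite normrM; apply: ler_pM => //; first exact: shrink_factor_bound.
  by apply: dshrink_coord_bound => //; exact: log_abs_le_log_norm.
apply: zero_mean_sub.
- apply: (integrable_normal_coordM v0 r (mtz i) _ mf fb) => -[[z w] t] /=.
  by rewrite tnth_upd eqxx.
- exact: (bounded_integrable pi mdf dfb).
apply: (stein_normal_coord v0 r (mtz i) _ mf mdf fb dfb).
- by move=> [[z w] t] /=; rewrite tnth_upd eqxx.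
- move=> [z w] t /=; rewrite /shrink /dshrink.
  set Q := \sum_(j | j != i) expR (p * log_abs e (tnth z j)).
  have Q0 : 0 <= Q by apply: sumr_ge0 => j _; exact: expR_ge0.
  rewrite (_ : (fun t => _) = (fun t => shrink_factor (S (z, w)) *
      shrink_coord a e Psi (log_scale e N (S (z, w))) (log_norm_coord p e Q t) t)); last first.
    by apply/funext => u; rewrite log_norm_upd tnth_upd eqxx.
  rewrite log_norm_upd -/Q tnth_upd eqxx.
  have h := is_derive_shrink_coord a p0 e0 dP (log_scale e N (S (z, w))) t Q0.
  change (S (upd i (z, t), w)) with (S (z, w)).
  exact: is_deriveZ.
- move=> [z w] /=; rewrite /dshrink.
  set Q := \sum_(j | j != i) expR (p * log_abs e (tnth z j)).
  have Q0 : 0 <= Q by apply: sumr_ge0 => j _; exact: expR_ge0.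
  rewrite (_ : (fun t => _) = (fun t => shrink_factor (S (z, w)) *
      dshrink_coord p a e Psi dPsi (log_scale e N (S (z, w))) (log_norm_coord p e Q t) t)); last first.
    by apply/funext => u; rewrite log_norm_upd tnth_upd eqxx.
  move=> t; apply: cvgM; first exact: cvg_cst.
  exact: continuous_dshrink_coord.
Qed.

Lemma weight_sum_ge0 z : 0 <= weight_sum z.
Proof. by apply: sumr_ge0 => i _; exact: sqr_ge0. Qed.

Lemma weight_sum_le z : weight_sum z <= d%:R * (1 + e^-1) ^+ 2.
Proof.
rewrite -[in leRHS](card_ord d) mulr_natl -sumr_const.
apply: ler_sum => i _; rewrite -[leLHS]ger0_norm ?sqr_ge0// normrX.
rewrite ler_sqr ?nnegrE ?addr_ge0//.
exact: (expR_weight_sqr_le a1 e0 (log_abs_le_log_norm i z)).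
Qed.

(** Stein's identity in w_j, for the quadratic term of the loss. *)
Lemma zero_mean_scale j : zero_mean pi (fun zw =>
  (tnth zw.2 j - 0) * scale_coord e N Psi (log_norm zw.1) (weight_sum zw.1) (S zw) (tnth zw.2 j) -
  1 * dscale_coord e N Psi dPsi v (log_norm zw.1) (weight_sum zw.1) (S zw) (tnth zw.2 j)).
Proof.
have r0 : resampled (@std_normal_vec R n) (normal1 0 1) (upd j).
  have := resampled_normal_vec ([tuple of nseq n 0] : n.-tuple R) 1 j.
  by rewrite tnth_nseq.
have r := resampled_pairr (normal_vec theta v) r0.
have mf : measurable_fun setT (fun zw : T =>
    scale_coord e N Psi (log_norm zw.1) (weight_sum zw.1) (S zw) (tnth zw.2 j)).
  exact: measurable_funM.
have mdf : measurable_fun setT (fun zw : T =>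
    dscale_coord e N Psi dPsi v (log_norm zw.1) (weight_sum zw.1) (S zw) (tnth zw.2 j)).
  apply: measurable_funD => //; apply: measurable_funM => //.
  by apply: measurable_funM => //; exact: measurable_funX.
set q1 := d%:R * (1 + e^-1) ^+ 2.
set b1 := e^-1 * (1 + (v * e)^-1) * M ^+ 2 * q1.
set b2 := 2 * (e^-1 * (M ^+ 2 + M * B) * q1).
have q10 : 0 <= q1 by rewrite mulr_ge0 ?sqr_ge0.
have ve0 : 0 <= (v * e)^-1 by rewrite invr_ge0 mulr_ge0// ltW.
have c10 : 0 <= e^-1 * (1 + (v * e)^-1) * M ^+ 2 :=
  mulr_ge0 (mulr_ge0 ie0 (addr_ge0 ler01 ve0)) (sqr_ge0 M).
have c20 : 0 <= e^-1 * (M ^+ 2 + M * B) :=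
  mulr_ge0 ie0 (addr_ge0 (sqr_ge0 M) (mulr_ge0 M0 B0)).
have b10 : 0 <= b1 := mulr_ge0 c10 q10.
have b20 : 0 <= b2 := mulr_ge0 (ler0n R 2) (mulr_ge0 c20 q10).
have ts (zw : T) : v * tnth zw.2 j ^+ 2 <= S zw.
  rewrite ler_pM2l// /sum_sqr (bigD1 j)//= lerDl.
  by apply: sumr_ge0 => k _; exact: sqr_ge0.
have fb (zw : T) : `|scale_coord e N Psi (log_norm zw.1) (weight_sum zw.1) (S zw) (tnth zw.2 j)| <= b1 + b2.
  have [h _] := scale_coord_bound N e0 PM dPB v0 (log_norm zw.1) (weight_sum_ge0 zw.1) (ts zw).
  apply: (le_trans h); apply: (@le_trans _ _ b1); last by rewrite lerDl.
  by rewrite ler_wpM2l// weight_sum_le.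
have dfb (zw : T) : `|dscale_coord e N Psi dPsi v (log_norm zw.1) (weight_sum zw.1) (S zw) (tnth zw.2 j)| <= b1 + b2.
  have [_ h] := scale_coord_bound N e0 PM dPB v0 (log_norm zw.1) (weight_sum_ge0 zw.1) (ts zw).
  apply: (le_trans h); apply: lerD; first by rewrite ler_wpM2l// weight_sum_le.
  by rewrite ler_pM2l// ler_wpM2l// weight_sum_le.
have up2 (zwt : T * R) : tnth (zwt.1.1, upd j (zwt.1.2, zwt.2)).2 j = zwt.2.
  by rewrite /= tnth_upd eqxx.
apply: zero_mean_sub.
- exact: (integrable_normal_coordM ltr01 r (mtw j) up2 mf fb).
- exact: (bounded_integrable pi mdf dfb).
apply: (stein_normal_coord ltr01 r (mtw j) up2 mf mdf fb dfb).
- move=> [z w] t /=; set q := \sum_(k | k != j) tnth w k ^+ 2.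
  have c0 : 0 <= q by apply: sumr_ge0 => k _; exact: sqr_ge0.
  rewrite /S /= (_ : (fun t => _) = (fun t =>
      scale_coord e N Psi (log_norm z) (weight_sum z) (v * (q + t ^+ 2)) t)); last first.
    by apply/funext => u; rewrite sum_sqr_upd tnth_upd eqxx.
  rewrite sum_sqr_upd -/q tnth_upd eqxx.
  exact: is_derive_scale_coord.
- move=> [z w] /=; set q := \sum_(k | k != j) tnth w k ^+ 2.
  have c0 : 0 <= q by apply: sumr_ge0 => k _; exact: sqr_ge0.
  rewrite /S /= (_ : (fun t => _) = (fun t =>
      dscale_coord e N Psi dPsi v (log_norm z) (weight_sum z) (v * (q + t ^+ 2)) t)); last first.
    by apply/funext => u; rewrite sum_sqr_upd tnth_upd eqxx.
  exact: continuous_dscale_coord.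
Qed.

Lemma zero_mean_variance i : zero_mean pi (fun zw =>
  (tnth zw.1 i - tnth theta i) ^+ 2 - v * 1).
Proof.
have r := resampled_pairl (std_normal_vec n) (resampled_normal_vec theta v i).
have up1 (zwt : T * R) : tnth (upd i (zwt.1.1, zwt.2), zwt.1.2).1 i = zwt.2.
  by rewrite /= tnth_upd eqxx.
apply: zero_mean_sub.
- exact: (integrable_normal_coord_sqr v0 r (mtz i) up1).
- exact: finite_measure_integrable_cst.
rewrite (integral_normal_coord_sqr v0 r (mtz i) up1).
rewrite (integral_cst pi measurableT 1%:E) mul1e.
by rewrite [X in (_ * X)%E]probability_setT mule1.
Qed.

Let c : R := d%:R - 2 - a * (d%:R - 1).
Let k : R := Num.min 1 (d%:R `^ ((2 - a) / p - 1)).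
Hypotheses (d0 : (0 < d)%N) (c0 : 0 < c) (ME : M = 2 * c * k).
Hypothesis drift : forall t,
  0 <= dPsi t * (M + 2 * c / N * Psi t) + c * Psi t * (M - Psi t).

(** The nonnegative factor s t / N expR (- 2 L) splits off, and the remaining
    bracket is the expression of shrinkage_drift_le0 plus a term from the
    damping of s, which is nonpositive. *)
Lemma drift_pointwise (zw : T) :
  - 2 * (\sum_i shrink_factor (S zw) * dshrink i zw.1 (S zw)) + N^-1 ^+ 2 *
   (\sum_j dscale_coord e N Psi dPsi v (log_norm zw.1) (weight_sum zw.1) (S zw) (tnth zw.2 j)) <= 0.
Proof.
set L := log_norm zw.1; set s := S zw; set l := L - log_scale e N s.
have s0 : 0 <= s by exact: S0.
have es := es0 s0; have se : 0 < s + e by rewrite ltr_wpDl.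
set t := (1 + e * s)^-1.
have t0 : 0 < t by rewrite invr_gt0.
have t1 : t <= 1 by rewrite invf_le1// lerDl mulr_ge0// ltW.
have sg0 : 0 <= s / (s + e) by rewrite divr_ge0// ltW.
have sg1 : s / (s + e) <= 1 by rewrite ler_pdivrMr// mul1r lerDl ltW.
pose x i := p * (log_abs e (tnth zw.1 i) - L).
pose rho i := tnth zw.1 i ^+ 2 / (tnth zw.1 i ^+ 2 + e).
pose b i := expR (- (a / p) * x i).
have bE i : expR ((a - 2) * L - a * log_abs e (tnth zw.1 i)) = expR (- 2 * L) * b i.
  by rewrite -expRD; congr expR; rewrite /x; field; rewrite gt_eqF.
have rho01 i : 0 <= rho i <= 1 by exact: ratio_sqr_itv.
have x1 : \sum_i expR (x i) = 1 by exact: (sum_weights (Ordinal d0)).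
have /andP[f0 fM] := PM l; rewrite ME in fM.
have hP := drift l; rewrite ME in hP.
have := shrinkage_drift_le0 p0 a0 a1 N0 c0 x1 rho01 f0 fM hP (ltW t0) t1 sg0 sg1.
rewrite -/b; set X := \sum_i b i * expR (x i) * rho i.
set W := \sum_i b i * (1 - _ - _); set Y := \sum_i b i * expR ((2 - a) / p * x i) * rho i.
move=> main.
have Y0 : 0 <= Y.
  apply: sumr_ge0 => i _; have /andP[h _] := rho01 i.
  by apply: mulr_ge0 h; apply: mulr_ge0; exact: expR_ge0.
have E1 : \sum_i shrink_factor s * dshrink i zw.1 s =
    s * t / N * expR (- 2 * L) * (dPsi l * X + Psi l * W).
  rewrite [dPsi l * X]mulr_sumr [Psi l * W]mulr_sumr -big_split/= mulr_sumr; apply: eq_bigr => i _.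
  by rewrite /shrink_factor -/t /dshrink /dshrink_coord -/L -/l bE -/(x i) -/(rho i); ring.
have qE : weight_sum zw.1 = expR (- 2 * L) * Y.
  rewrite /weight_sum mulr_sumr; apply: eq_bigr => i _; rewrite -/L bE exprMn.
  have e2 := expR2_log_abs e0 (tnth zw.1 i).
  have h0 : 0 < tnth zw.1 i ^+ 2 + e by rewrite ltr_wpDl// sqr_ge0.
  have -> : expR ((2 - a) / p * x i) = b i * expR (- 2 * L) * (tnth zw.1 i ^+ 2 + e).
    by rewrite -e2 -!expRD; congr expR; rewrite /x; field; rewrite gt_eqF.
  by rewrite /rho; field; rewrite gt_eqF.
(* Summed over j, the terms w_j^2 add up to s / v. *)
have E3 : \sum_j dscale_coord e N Psi dPsi v L (weight_sum zw.1) s (tnth zw.2 j) =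
    n%:R * radial e N Psi L (weight_sum zw.1) s + 2 * s * dradial e N Psi dPsi L (weight_sum zw.1) s.
  rewrite /dscale_coord big_split/= sumr_const card_ord; congr (_ + _); first by rewrite mulr_natl.
  by rewrite -mulr_suml -mulr_sumr -[2 * v * _]mulrA.
(* Differentiating the factor s of radial adds 2 to n, which is why N = n + 2. *)
have nE : n%:R = N - 2 by rewrite /N addrK.
rewrite E1 E3 nE qE /radial /dradial -/l -/t.
rewrite [leLHS](_ : _ = s * t / N * expR (- 2 * L) * (- 2 * (dPsi l * X + Psi l * W) +
    t * (Psi l ^+ 2 - 2 / N * Psi l * dPsi l * (s / (s + e))) * Y
    - 4 * (e * s * t) / N * t * Psi l ^+ 2 * Y)).
  apply: mulr_ge0_le0.
    apply: mulr_ge0 (expR_ge0 _); apply: divr_ge0 (ltW N0).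
    exact: mulr_ge0 s0 (ltW t0).
  have h : 0 <= 4 * (e * s * t) / N * t * Psi l ^+ 2 * Y.
    apply: mulr_ge0 Y0; apply: mulr_ge0 (sqr_ge0 _); apply: mulr_ge0 (ltW t0).
    apply: divr_ge0 (ltW N0); apply: mulr_ge0 => //.
    by apply: mulr_ge0 (ltW t0); rewrite mulr_ge0// ltW.
  by rewrite subr_le0 (le_trans main).
by field; rewrite !gt_eqF.
Qed.

(** Splits the loss into the risk of z, the linear and the quadratic term,
    each in the form of a zero-mean lemma. *)
Lemma loss_decomposition (zw : T) :
  loss (regularised zw.1 (S zw)) theta v =
  v^-1 * (\sum_i (tnth zw.1 i - tnth theta i) ^+ 2)
  - 2 / v * (\sum_i (tnth zw.1 i - tnth theta i) * (shrink_factor (S zw) * shrink i zw.1 (S zw)))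
  + N^-1 ^+ 2 * (\sum_j (tnth zw.2 j - 0) *
      scale_coord e N Psi (log_norm zw.1) (weight_sum zw.1) (S zw) (tnth zw.2 j)).
Proof.
set s := S zw; have s0 : 0 <= s by exact: S0.
have es := es0 s0.
have -> : \sum_j (tnth zw.2 j - 0) * scale_coord e N Psi (log_norm zw.1) (weight_sum zw.1) s (tnth zw.2 j) =
    s / v * radial e N Psi (log_norm zw.1) (weight_sum zw.1) s.
  have -> : s / v = sum_sqr zw.2 by rewrite mulrC mulrA mulVf ?gt_eqF// mul1r.
  rewrite /sum_sqr mulr_suml.
  by apply: eq_bigr => j _; rewrite subr0 /scale_coord; ring.
rewrite /radial /weight_sum !mulr_sumr -sumrB -big_split/=; apply: eq_bigr => i _.
rewrite tnth_mktuple /shrink /shrink_coord /shrink_factor -/s.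
by field; rewrite !gt_eqF.
Qed.

Lemma measurable_regularised :
  measurable_fun setT (fun zw : T => regularised zw.1 (v * sum_sqr zw.2)).
Proof.
apply/measurable_fun_tnthP => i.
apply: (eq_measurable_fun (fun zw : T => tnth zw.1 i - shrink_factor (S zw) * shrink i zw.1 (S zw))).
  by move=> zw _; rewrite /= tnth_mktuple.
by apply: measurable_funB => //; exact: measurable_funM.
Qed.

(** By the three Stein identities the loss exceeds d by a zero-mean function
    plus the nonpositive drift. *)
Lemma regularised_risk_le :
  (\int[pi]_zw (loss (regularised zw.1 (v * sum_sqr zw.2)%R) theta v)%:E <= d%:R%:E)%E.
Proof.
have [Zi Z0] := zero_meanD (zero_meanD
  (zero_meanZ v^-1 (zero_mean_sum zero_mean_variance))
  (zero_meanZ (- (2 / v)) (zero_mean_sum zero_mean_location)))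
  (zero_meanZ (N^-1 ^+ 2) (zero_mean_sum zero_mean_scale)).
set Zm := (fun x => _) in Zi Z0.
have lossE zw : loss (regularised zw.1 (S zw)) theta v <= Zm zw + d%:R.
  rewrite loss_decomposition -subr_ge0.
  apply: le_trans (_ : 0 <= - (- 2 * (\sum_i shrink_factor (S zw) * dshrink i zw.1 (S zw)) + N^-1 ^+ 2 *
   (\sum_j dscale_coord e N Psi dPsi v (log_norm zw.1) (weight_sum zw.1) (S zw) (tnth zw.2 j)))) _.
    by rewrite oppr_ge0 drift_pointwise.
  rewrite le_eqVlt; apply/orP; left; apply/eqP; rewrite /Zm !sumrB.
  rewrite -!mulr_sumr mul1r sumr_const card_ord.
  by field; rewrite !gt_eqF.
have l0 zw : 0 <= loss (regularised zw.1 (S zw)) theta v by rewrite loss_ge0// ltW.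
have mZ : measurable_fun setT (fun zw => (Zm zw)%:E) := measurable_int _ Zi.
apply: (@le_trans _ _ (\int[pi]_zw ((Zm zw)%:E + d%:R%:E))%E).
  apply: ge0_le_integral => //.
  - by move=> zw _; rewrite lee_fin.
  - by apply/measurable_EFinP; apply: measurable_loss => //; exact: measurable_regularised.
  - by apply: emeasurable_funD.
  - by move=> zw _; rewrite -EFinD lee_fin; exact: lossE.
rewrite integralD//; last exact: finite_measure_integrable_cst.
rewrite Z0 add0e (integral_cst pi measurableT d%:R%:E).
by rewrite [X in (_ * X)%E]probability_setT mule1.
Qed.

End regularised_estimator.

(** * Passage to the limit *)

Section limit.
Context {R : realType}.

(** Fatou's lemma, in the form in which it carries a bound on the risks over
    to a pointwise limit. *)
Lemma fatou_le d (T : measurableType d) (pi : probability T R)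
    (f : nat -> T -> R) (F : T -> R) (C : \bar R) :
  (forall k, measurable_fun setT (f k)) -> (forall k x, 0 <= f k x) ->
  (forall x, f k x @[k --> \oo] --> F x) ->
  (forall k, \int[pi]_x (f k x)%:E <= C)%E -> (\int[pi]_x (F x)%:E <= C)%E.
Proof.
move=> mf f0 fF fC.
have mfe k : measurable_fun setT (fun x => (f k x)%:E) by exact/measurable_EFinP.
have f0e k (x : T) : setT x -> (0 <= (f k x)%:E)%E by rewrite lee_fin.
have := fatou pi measurableT mfe f0e.
have -> : (\int[pi]_x limn_einf (fun k => (f k x)%:E) = \int[pi]_x (F x)%:E)%E.
  apply: eq_integral => x _.
  have h : (f k x)%:E @[k --> \oo] --> (F x)%:E by apply: cvg_EFin; [exact: nearW|exact: fF].
  by rewrite (cvg_limn_einf_sup h).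
move=> /le_trans; apply; rewrite limn_einf_lim; apply: lime_le; first exact: is_cvg_einfs.
apply: nearW => k; apply: le_trans (fC k).
by apply: ereal_inf_lbound; exists k => /=.
Qed.

(** One interval of the definition suffices. The absolute value extends phi
    from the half line, so that continuity and measurability can be used on
    the whole line. *)
Lemma abs_cont_continuous (phi : R -> R) :
  abs_cont phi -> continuous (fun u : R => phi `|u|).
Proof.
move=> hac u; apply/cvgrPdist_lt => e e0.
have b0 : 0 < `|u| + 1 by rewrite ltr_wpDl.
have [eta eta0 h] := hac _ b0 e e0.
apply/nbhs_ballP; exists (Num.min eta 1); first by rewrite /= lt_min eta0 ltr01.
move=> y; rewrite /ball /= lt_min => /andP[y1 y2].
have key (s t : R) : 0 <= s -> s <= t -> t <= `|u| + 1 -> t - s < eta -> `|phi t - phi s| < e.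
  move=> s0 st tb ts.
  have := h [:: (s, t)]; rewrite !big_seq1 /=; apply => //.
  by move=> I; rewrite inE => /eqP ->.
have d1 : `| `|u| - `|y| | <= `|u - y| by exact: ler_dist_dist.
have yb : `|y| <= `|u| + 1.
  by have := ler_normD u (y - u); rewrite addrC subrK distrC; lra.
have [uy|/ltW yu] := leP `|u| `|y|.
  rewrite distrC; apply: key => //; apply: le_lt_trans y1; apply: le_trans d1.
  by rewrite distrC ler_norm.
apply: key => //; first by rewrite lerDl.
by apply: le_lt_trans y1; apply: le_trans d1; exact: ler_norm.
Qed.

Lemma cvg_sum_ord m (f : 'I_m -> nat -> R) (l : 'I_m -> R) :
  (forall i, f i k @[k --> \oo] --> l i) ->
  \sum_i f i k @[k --> \oo] --> \sum_i l i.
Proof.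
elim: m f l => [|m IH] f l fl.
  by under eq_fun do rewrite big_ord0; rewrite big_ord0; exact: cvg_cst.
under eq_fun do rewrite big_ord_recl; rewrite big_ord_recl.
by apply: cvgD; [exact: fl|apply: IH => i; exact: fl].
Qed.

Let e_ (k : nat) : R := k.+1%:R^-1.

Let e_gt0 k : 0 < e_ k. Proof. by rewrite invr_gt0. Qed.

Let cvg_e : e_ k @[k --> \oo] --> 0. Proof. exact: cvg_harmonic. Qed.

Let cvg_addre (r : R) : r + e_ k @[k --> \oo] --> r.
Proof.
by rewrite -[X in _ --> X]addr0; apply: cvgD; [exact: cvg_cst|exact: cvg_e].
Qed.

Lemma cvg_expR_log_abs (p t : R) : 0 < p ->
  expR (p * log_abs (e_ k) t) @[k --> \oo] --> `|t| `^ p.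
Proof.
move=> p0.
have E k : expR (p * log_abs (e_ k) t) = (t ^+ 2 + e_ k) `^ (p / 2).
  have h : 0 < t ^+ 2 + e_ k by rewrite ltr_wpDl ?sqr_ge0.
  by rewrite /powR gt_eqF// /log_abs; congr expR; ring.
under eq_fun do rewrite E.
have [->|t0] := eqVneq t 0.
  rewrite normr0 powR0 ?gt_eqF// expr0n /=.
  have p2 : 0 < p / 2 by rewrite divr_gt0.
  have h := (cvg_at_rightP _ _ _).1 (powR_cvg0 p2) e_ (conj e_gt0 cvg_e).
  by under eq_fun do rewrite add0r.
have t2 : 0 < t ^+ 2 by rewrite exprn_even_gt0.
have -> : `|t| `^ p = (t ^+ 2) `^ (p / 2).
  by rewrite -real_normK ?num_real// -powR_mulrn// -powRrM; congr (_ `^ _); field.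
rewrite /powR gt_eqF//.
have E2 k : (if t ^+ 2 + e_ k == 0 then (p / 2 == 0)%:R else expR (p / 2 * ln (t ^+ 2 + e_ k))) =
    expR (p / 2 * ln (t ^+ 2 + e_ k)).
  by rewrite gt_eqF// ltr_wpDl ?sqr_ge0.
under eq_fun do rewrite E2.
apply: (cvg_comp _ expR); last exact: continuous_expR.
apply: cvgM; first exact: cvg_cst.
apply: (cvg_comp _ (@ln R)); last exact: continuous_ln t2.
exact: cvg_addre.
Qed.

Lemma cvg_log_abs (t : R) : t != 0 -> log_abs (e_ k) t @[k --> \oo] --> ln `|t|.
Proof.
move=> t0; have t2 : 0 < t ^+ 2 by rewrite exprn_even_gt0.
have -> : ln `|t| = ln (t ^+ 2) / 2.
  by rewrite -real_normK ?num_real// lnXn ?normr_gt0// mulr2n; field.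
apply: cvgM; last exact: cvg_cst.
apply: (cvg_comp _ (@ln R)); last exact: continuous_ln t2.
exact: cvg_addre.
Qed.

(** By the mean value property Psi k (u k) is a value of psi at a point
    squeezed to t. *)
Lemma cvg_smooth (psi : R -> R) (Psi : nat -> R -> R) (u : nat -> R) (t : R) :
  continuous psi ->
  (forall k s, exists2 x, s <= x <= s + e_ k & Psi k s = psi x) ->
  u k @[k --> \oo] --> t -> Psi k (u k) @[k --> \oo] --> psi t.
Proof.
move=> cpsi hPsi ut.
have /choice[x hx] : forall k, exists x, u k <= x <= u k + e_ k /\ Psi k (u k) = psi x.
  by move=> k; have [x h1 h2] := hPsi k (u k); exists x.
under eq_fun do rewrite (hx _).2.
apply: (cvg_comp _ psi); last exact: cpsi.
apply: (squeeze_cvgr _ ut (h := fun k => u k + e_ k)).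
  by apply: nearW => k; have [] := hx k.
by rewrite -[X in _ --> X]addr0; apply: cvgD; [exact: ut|exact: cvg_e].
Qed.

Section pointwise.
Variables (d n : nat) (p a : R) (phi : R -> R) (Psi : nat -> R -> R).
Hypotheses (p0 : 0 < p) (cpsi : continuous (fun t : R => phi (expR t))).
Hypothesis hPsi : forall k s, exists2 x, s <= x <= s + e_ k & Psi k s = phi (expR x).

(** Convergence holds at every z and every s >= 0: at s = 0 and at z_i = 0,
    where the estimator is not given by a regular expression, both sides
    reduce to z_i. *)
Lemma cvg_regularised (z : d.-tuple R) (s : R) (i : 'I_d) : 0 <= s ->
  tnth (regularised n p a (e_ k) (Psi k) z s) i @[k --> \oo] -->
  tnth (theta_hat n p a phi z s) i.
Proof.
rewrite le_eqVlt => /predU1P[<-|s0]; rewrite tnth_mktuple.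
  rewrite /sigma2_hat mul0r mul0r mul0r subr0 mul1r.
  under eq_fun do rewrite tnth_mktuple /shrink_factor !mul0r subr0.
  exact: cvg_cst.
(* A zero coordinate is multiplied by its own value on both sides. *)
have [zi0|zi0] := eqVneq (tnth z i) 0.
  under eq_fun do rewrite tnth_mktuple /shrink /shrink_coord zi0 !mulr0 subr0.
  by rewrite zi0 mulr0; exact: cvg_cst.
suff : tnth z i - shrink_factor n (e_ k) s * shrink n p a (e_ k) (Psi k) i z s @[k --> \oo] -->
    (1 - sigma2_hat n s * phi (pnorm p z / Num.sqrt (sigma2_hat n s)) /
    (pnorm p z `^ (2 - a) * `|tnth z i| `^ a)) * tnth z i.
  by move=> h; under eq_fun do rewrite tnth_mktuple.
pose N : R := n%:R + 2.
have N0 : 0 < N by rewrite ltr_wpDl.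
pose H := \sum_(j < d) `|tnth z j| `^ p.
have H0 : 0 < H.
  rewrite /H (bigD1 i)//= ltr_pwDl ?powR_gt0 ?normr_gt0//.
  by apply: sumr_ge0 => j _; exact: powR_ge0.
have cH : log_norm p (e_ k) z @[k --> \oo] --> ln H / p.
  apply: cvgM; last exact: cvg_cst.
  apply: (cvg_comp _ (@ln R)); last exact: continuous_ln H0.
  by apply: (cvg_sum_ord (f := fun j k => expR (p * log_abs (e_ k) (tnth z j)))) => j; exact: cvg_expR_log_abs.
have csN : log_scale (e_ k) N s @[k --> \oo] --> ln (s / N) / 2.
  apply: cvgM; last exact: cvg_cst.
  apply: (cvg_comp _ (@ln R)); last by apply: continuous_ln; exact: divr_gt0.
  apply: cvgM; last exact: cvg_cst.
  exact: cvg_addre.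
have ckap : shrink_factor n (e_ k) s @[k --> \oo] --> s / N.
  apply: cvgM; last exact: cvg_cst.
  rewrite -[X in _ --> X]mulr1; apply: cvgM; first exact: cvg_cst.
  rewrite -[X in _ --> X]invr1; apply: cvgV; first exact: oner_neq0.
  rewrite -[X in _ --> X]addr0; apply: cvgD; first exact: cvg_cst.
  by rewrite -[X in _ --> X](mul0r s); apply: cvgM; [exact: cvg_e|exact: cvg_cst].
have pE : pnorm p z = expR (ln H / p).
  by rewrite /pnorm -/H /powR gt_eqF// mulrC.
have sE : Num.sqrt (s / N) = expR (ln (s / N) / 2).
  have sN : 0 < s / N by exact: divr_gt0.
  by rewrite -powR12_sqrt ?(ltW sN)// /powR gt_eqF// mulrC.
have cPsi := cvg_smooth cpsi hPsi (cvgB cH csN).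
rewrite /= in cPsi.
have phiE : phi (pnorm p z / Num.sqrt (sigma2_hat n s)) = phi (expR (ln H / p - ln (s / N) / 2)).
  by rewrite /sigma2_hat -/N pE sE expRD expRN.
have -> : (1 - sigma2_hat n s * phi (pnorm p z / Num.sqrt (sigma2_hat n s)) /
    (pnorm p z `^ (2 - a) * `|tnth z i| `^ a)) * tnth z i =
  tnth z i - s / N * (phi (expR (ln H / p - ln (s / N) / 2)) *
    expR ((a - 2) * (ln H / p) - a * ln `|tnth z i|) * tnth z i).
  rewrite phiE /sigma2_hat -/N.
  have -> : expR ((a - 2) * (ln H / p) - a * ln `|tnth z i|) =
      (pnorm p z `^ (2 - a) * `|tnth z i| `^ a)^-1.
    rewrite pE /powR !gt_eqF ?expR_gt0 ?normr_gt0// expRK -expRD -expRN.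
    by congr expR; ring.
  by ring.
apply: cvgB; first exact: cvg_cst.
apply: cvgM; first exact: ckap.
apply: cvgM; last exact: cvg_cst.
apply: cvgM; first exact: cPsi.
apply: (cvg_comp _ expR); last exact: continuous_expR.
apply: cvgB; apply: cvgM; [exact: cvg_cst|exact: cH|exact: cvg_cst|exact: cvg_log_abs].
Qed.

End pointwise.

(** All powers and inverses are of nonnegative quantities, so the formula is
    measurable also on the null set where a coordinate vanishes. *)
Lemma estimator_theta_hat d n (p a : R) (phi : R -> R) :
  continuous (fun u : R => phi `|u|) ->
  estimator (@theta_hat R d n p a phi).
Proof.
move=> cphi; apply/measurable_fun_tnthP => i.
pose T := (d.-tuple R * R)%type.
have mz j : measurable_fun setT (fun zs : T => tnth zs.1 j).
  by apply: (@measurableT_comp _ _ _ _ _ _ (fun x : d.-tuple R => tnth x j)) => //; exact: measurable_tnth.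
have msg : measurable_fun setT (fun zs : T => sigma2_hat n zs.2).
  exact: measurable_funM.
have mabs j (r : R) : measurable_fun setT (fun zs : T => `|tnth zs.1 j| `^ r).
  apply: (measurableT_comp (@measurable_powR R r)).
  exact: measurableT_comp.
have mp : measurable_fun setT (fun zs : T => pnorm p zs.1).
  apply: (measurableT_comp (@measurable_powR R _)).
  by apply: measurable_sum => j; exact: mabs.
have mphi : measurable_fun setT (fun zs : T => phi (pnorm p zs.1 / Num.sqrt (sigma2_hat n zs.2))).
  apply: (eq_measurable_fun (fun zs : T => phi `| pnorm p zs.1 / Num.sqrt (sigma2_hat n zs.2)|)).
    by move=> zs _; rewrite ger0_norm// divr_ge0 ?powR_ge0 ?sqrtr_ge0.
  apply: (measurableT_comp (continuous_measurable_fun cphi)).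
  apply: measurable_funM => //; apply: ge0_measurable_funV.
    apply: (measurableT_comp (continuous_measurable_fun (@sqrt_continuous R))) => //.
  by move=> zs; exact: sqrtr_ge0.
apply: (eq_measurable_fun (fun zs : T =>
  (1 - sigma2_hat n zs.2 * phi (pnorm p zs.1 / Num.sqrt (sigma2_hat n zs.2)) /
     (pnorm p zs.1 `^ (2 - a) * `|tnth zs.1 i| `^ a)) * tnth zs.1 i)).
  by move=> zs _; rewrite /= tnth_mktuple.
apply: measurable_funM => //; apply: measurable_funB => //.
apply: measurable_funM; first exact: measurable_funM.
apply: ge0_measurable_funV.
  apply: measurable_funM => //.
  exact: (measurableT_comp (@measurable_powR R _)).
by move=> zs; rewrite mulr_ge0 ?powR_ge0.
Qed.

End limit.

(** * Minimaxity *)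

(** The factor d - 2 cancels the denominator of gamma, leaving twice c = d - 2
    - a (d - 1) times the minimum. *)
Lemma phi_boundE (R : realType) d (p a : R) : (3 <= d)%N -> 0 < p ->
  phi_bound d p a = 2 * (d%:R - 2 - a * (d%:R - 1)) *
    Num.min 1 (d%:R `^ ((2 - a) / p - 1)).
Proof.
move=> hd p0; have d2 : d%:R - 2 != 0 :> R.
  by rewrite gt_eqF// subr_gt0 ltr_nat.
rewrite /phi_bound /gamma (_ : (2 - p - a) / p = (2 - a) / p - 1); last first.
  by field; rewrite gt_eqF.
by set k := Num.min _ _; field.
Qed.

(** In the logarithmic variable the hypotheses on g_phi become the
    finite-difference bound of smooth_profile; window lengths and
    regularisation 1 / (j + 1) then give approximations of risk at most d. *)
Lemma risk_theta_hat_le (R : realType) (d n : nat) (p alpha : R) (phi : R -> R)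
    (disp : measure_display) (Omega : measurableType disp)
    (P : d.-tuple R -> R -> probability Omega R)
    (Z : {mfun Omega >-> d.-tuple R}) (S : {mfun Omega >-> R})
    (theta : d.-tuple R) (v : R) :
  normal_chi2_model n P Z S -> (3 <= d)%N -> 0 < p ->
  0 <= alpha -> alpha < (d%:R - 2) / (d%:R - 1) ->
  continuous (fun u : R => phi `|u|) ->
  (forall u : R, 0 <= u -> 0 <= phi u /\ phi u <= phi_bound d p alpha) ->
  (forall u v : R, 0 <= u -> u <= v ->
      phi u < phi_bound d p alpha -> phi v < phi_bound d p alpha ->
      g_phi d n p alpha phi u <= g_phi d n p alpha phi v) ->
  (forall ustar : R, 0 < ustar -> phi ustar = phi_bound d p alpha ->
      forall u : R, ustar <= u -> phi u = phi_bound d p alpha) ->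
  0 < v ->
  (risk P Z S (theta_hat n p alpha phi) theta v <= d%:R%:E)%E.
Proof.
move=> hmodel hd p0 a0 ha cphi hphi hg hsat v0.
have d1 : 0 < d%:R - 1 :> R by rewrite subr_gt0 ltr1n; case: d hd {hmodel theta P Z S ha hphi hg hsat} => [|[]].
set c := d%:R - 2 - alpha * (d%:R - 1).
have c0 : 0 < c by rewrite subr_gt0 -ltr_pdivlMr.
have a1 : alpha <= 1.
  apply: ltW; apply: (lt_trans ha); rewrite ltr_pdivrMr// mul1r; lra.
have d0 : (0 < d)%N by exact: leq_trans hd.
set k := Num.min 1 (d%:R `^ ((2 - alpha) / p - 1)).
have k0 : 0 < k by rewrite lt_min ltr01 powR_gt0// ltr0n.
have ME : phi_bound d p alpha = 2 * c * k by exact: phi_boundE.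
set M := phi_bound d p alpha in ME hphi hg hsat.
have M0 : 0 < M by rewrite ME !mulr_gt0.
pose N : R := n%:R + 2.
have N0 : 0 < N by rewrite ltr_wpDl.
have be0 : 0 <= 2 * c / N by rewrite divr_ge0 ?(ltW N0)// mulr_ge0// ltW.
pose psi t := phi (expR t).
have psi01 t : 0 <= psi t <= M by apply/andP; exact: hphi (expR_ge0 t).
have cpsi : continuous psi.
  rewrite (_ : psi = (fun u => phi `|u|) \o expR); last first.
    by apply/funext => t; rewrite /psi /= ger0_norm ?expR_ge0.
  by move=> t; apply: continuous_comp; [exact: continuous_expR|exact: cphi].
have drop t dl : 0 <= dl -> psi t - psi (t + dl) <=
    dl * (c * psi t * (M - psi t) / (M + 2 * c / N * psi t)) + c ^+ 2 * M / 4 * dl ^+ 2.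
  move=> dl0; have /andP[x0 xM] := psi01 t; have /andP[y0 yM] := psi01 (t + dl).
  apply: (log_derivative_drop (t := t)) => //.
    move=> xlt ylt; by apply: hg => //; rewrite ler_expR lerDl.
  by move=> xE; apply: (hsat _ (expR_gt0 t) xE); rewrite ler_expR lerDl.
have e_gt0 (j : nat) : 0 < j.+1%:R^-1 :> R by rewrite invr_gt0.
have /choice[F hF] : forall j : nat, exists F : (R -> R) * (R -> R),
  [/\ forall t : R, is_derive t 1 F.1 (F.2 t),
      continuous F.2,
      forall t, 0 <= F.1 t <= M /\ `|F.2 t| <= M / j.+1%:R^-1,
      forall t, 0 <= F.2 t * (M + 2 * c / N * F.1 t) + c * F.1 t * (M - F.1 t)
    & forall t, exists2 x, t <= x <= t + j.+1%:R^-1 & F.1 t = psi x].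
  move=> j; have [Psi [dPsi h]] := smooth_profile c0 be0 M0 (e_gt0 j) cpsi psi01 drop.
  by exists (Psi, dPsi).
rewrite (risk_integral hmodel _ v0); last exact: estimator_theta_hat.
set pi := (_ \x _)%E.
pose T := (d.-tuple R * n.-tuple R)%type.
pose dl (j : nat) (zw : T) := regularised n p alpha j.+1%:R^-1 (F j).1 zw.1 (v * sum_sqr zw.2).
apply: (fatou_le (f := fun j zw => loss (dl j zw) theta v)).
- move=> j; apply: measurable_loss => //; have [h1 _ _ _ _] := hF j.
  exact: (@measurable_regularised R d n p alpha _ v _ _ (e_gt0 j) v0 h1).
- by move=> j zw; rewrite loss_ge0// ltW.
- move=> zw; apply: (cvg_sum_ord (f := fun i j => (tnth (dl j zw) i - tnth theta i) ^+ 2 / v)) => i.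
  apply: cvgM; last exact: cvg_cst.
  have h : tnth (dl j zw) i @[j --> \oo] -->
      tnth (theta_hat n p alpha phi zw.1 (v * sum_sqr zw.2)) i.
    apply: (@cvg_regularised R d n p alpha phi (fun j => (F j).1) p0 cpsi).
      by move=> j s; have [_ _ _ _ h] := hF j; exact: h.
    by rewrite mulr_ge0 ?(ltW v0)// sum_sqr_ge0.
  by rewrite !expr2; apply: cvgM; apply: cvgB; [exact: h|exact: cvg_cst|exact: h|exact: cvg_cst].
move=> j; have [h1 h2 h3 h4 _] := hF j.
apply: (regularised_risk_le theta p0 a0 a1 (e_gt0 j) v0 _ _ h1 h2 d0 c0 ME h4).
- by move=> t; have [] := h3 t.
- by move=> t; have [_] := h3 t; exact.
Qed.

Unset Implicit Arguments.
Set Strict Implicit.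
Set Printing Implicit Defensive.

Theorem theorem3p2 (R : realType) (d n : nat) (p alpha : R) (phi : R -> R)
    (disp : measure_display) (Omega : measurableType disp)
    (P : d.-tuple R -> R -> probability Omega R)
    (Z : {mfun Omega >-> d.-tuple R}) (S : {mfun Omega >-> R})
    (hmodel : normal_chi2_model n P Z S)
    (hn : (1 <= n)%N) (hd : (3 <= d)%N) (hp : 0 < p)
    (halpha0 : 0 <= alpha) (halpha : alpha < (d%:R - 2) / (d%:R - 1))
    (hac : abs_cont phi)
    (hphi : forall u : R, 0 <= u -> 0 <= phi u /\ phi u <= phi_bound d p alpha)
    (hg : forall u v : R, 0 <= u -> u <= v ->
      phi u < phi_bound d p alpha -> phi v < phi_bound d p alpha ->
      g_phi d n p alpha phi u <= g_phi d n p alpha phi v)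
    (hsat : forall ustar : R, 0 < ustar -> phi ustar = phi_bound d p alpha ->
      forall u : R, ustar <= u -> phi u = phi_bound d p alpha) :
  minimax P Z S (theta_hat n p alpha phi).
Proof.
have cphi := abs_cont_continuous hac.
split; first exact: estimator_theta_hat.
move=> delta' hdelta'; apply: le_trans (max_risk_ge hmodel hdelta').
apply: ge_ereal_sup => _ [theta [v [v0 ->]]].
exact: risk_theta_hat_le.
Qed.
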